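(* (Narrow region principle for systems.) Let $n\ge2$, $\alpha\in(0,2)$ and $f,g,h,l\in C^1([0,+\infty)\times[0,+\infty),\mathbb{R})$. Let $(u,v)\in\left(L_\alpha\cap C^{1,\theta}_{loc}(\mathbb{R}^n)\right)^2$, for some $\theta>\max\{0,\alpha-1\}$, be a positive solution of the system $$\begin{cases}(-\Delta)^{\frac{\alpha}{2}}u(x)=f(u(x),v(x)), & x\in\mathbb{R}^n_+,\\ (-\Delta)^{\frac{\alpha}{2}}v(x)=g(u(x),v(x)), & x\in\mathbb{R}^n_+,\\ \mathcal{N}_{\frac{\alpha}{2}}u(x)=h(u(x),v(x)), & x\in\mathbb{R}^n\setminus\overline{\mathbb{R}^n_+},\\ \mathcal{N}_{\frac{\alpha}{2}}v(x)=l(u(x),v(x)), & x\in\mathbb{R}^n\setminus\overline{\mathbb{R}^n_+}.\end{cases}$$ Assume: (i') $\lim_{|x|\to\infty}u(x)=0$ and $\lim_{|x|\to\infty}v(x)=0$; (iv) $\frac{\partial f}{\partial v}>0$ and $\frac{\partial g}{\partial u}>0$ for all $(u,v)\in\mathbb{R}^+\times\mathbb{R}^+$; (v) $\frac{\partial h}{\partial u}<0$, $\frac{\partial l}{\partial v}<0$, $\frac{\partial h}{\partial v}>0$, $\frac{\partial l}{\partial u}>0$ for all $(u,v)\in\mathbb{R}^+\times\mathbb{R}^+$; (vi) $\mu,\nu>0$ are constants with $\mu\nu>1$ such that $-\frac{\partial h}{\partial u}\ge\mu\frac{\partial h}{\partial v}$ and $-\frac{\partial l}{\partial v}\ge\nu\frac{\partial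 l}{\partial u}$ for all $(u,v)\in\mathbb{R}^+\times\mathbb{R}^+$. Then there exists $\ell_0>0$ such that for each $\ell\in(0,\ell_0]$ and each $\lambda\in\mathbb{R}$, with $\Omega_{\lambda,\ell}:=\{x\in H_\lambda : \lambda-\ell<x_1<\lambda\}$: (c) if there is $x^*\in\Omega_{\lambda,\ell}$ such that $U_\lambda(x^* )=\min_{x\in\overline{H_\lambda}}U_\lambda(x)<0$, then $V_\lambda(x^* )<\mu U_\lambda(x^* )<0$; (d) if there is $y^*\in\Omega_{\lambda,\ell}$ such that $V_\lambda(y^* )=\min_{y\in\overline{H_\lambda}}V_\lambda(y)<0$, then $U_\lambda(y^* )<\nu V_\lambda(y^* )<0$.
   Context: $\mathbb{R}^n_+=\{x=(x_1,\dots,x_n)\in\mathbb{R}^n : x_n>0\}$ and $\mathbb{R}^+=(0,\infty)$. For $\lambda\in\mathbb{R}$, $H_\lambda=\{x\in\mathbb{R}^n : x_1<\lambda\}$ and $x^\lambda=(2\lambda-x_1,x_2,\dots,x_n)$ is the reflection of $x$ in the hyperplane $\{x_1=\lambda\}$ (here $x_1$ is a direction tangential to $\partial\mathbb{R}^n_+$, so $x_1\ne x_n$). Put $U_\lambda(x)=u(x^\lambda)-u(x)$ and $V_\lambda(x)=v(x^\lambda)-v(x)$. The fractional Laplacian is $$(-\Delta)^{\frac{\alpha}{2}}u(x)=C_{n,\alpha}\lim_{\epsilon\to0}\int_{\mathbb{R}^n\setminus B_\epsilon(x)}\frac{u(x)-u(y)}{|x-y|^{n+\alpha}}\,dy,$$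 where $C_{n,\alpha}>0$ is the usual normalization constant. The nonlocal normal derivative is $$\mathcal{N}_{\frac{\alpha}{2}}u(x)=C_{n,\alpha}\int_{\mathbb{R}^n_+}\frac{u(x)-u(y)}{|x-y|^{n+\alpha}}\,dy,\qquad x\in\mathbb{R}^n\setminus\overline{\mathbb{R}^n_+}\ (\text{i.e. }x_n<0).$$ $L_\alpha=\left\{u:\mathbb{R}^n\to\mathbb{R} : \int_{\mathbb{R}^n}\frac{|u(x)|}{1+|x|^{n+\alpha}}dx<\infty\right\}$. A positive solution means $u>0$ and $v>0$ on $\mathbb{R}^n$; equations are understood pointwise. Partial derivatives of $f,g,h,l$ with respect to $u$ and $v$ denote derivatives in the first and second argument. *)

(* Defs.v *)
(* R^n is the space of row vectors 'rV[R]_n over R : realType. *)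
From HB Require Import structures.
From mathcomp Require Import all_boot all_order all_algebra.
From mathcomp Require Import all_classical all_reals all_analysis.

Set Implicit Arguments.
Unset Strict Implicit.
Unset Printing Implicit Defensive.

Import Order.TTheory GRing.Theory Num.Theory.
Import numFieldNormedType.Exports.

Local Open Scope classical_set_scope.
Local Open Scope ring_scope.

(* The product sigma-algebra on row vectors (the Borel one when T is R). *)
Section measurable_rV.
Context {d} {T : measurableType d}.
Variable n : nat.

Let coors : 'I_n -> 'rV[T]_n -> T := fun i x => x ord0 i.

Let rV_set0 : g_sigma_preimage coors set0.
Proof. exact: sigma_algebra0. Qed.

Let rV_setC A : g_sigma_preimage coors A -> g_sigma_preimage coors (~` A).
Proof. exact: sigma_algebraC. Qed.

Let rV_bigcup (F : _^nat) : (forall i, g_sigma_preimage coors (F i)) ->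
  g_sigma_preimage coors (\bigcup_i (F i)).
Proof. exact: sigma_algebra_bigcup. Qed.

HB.instance Definition _ := @isMeasurable.Build (measure_tuple_display d)
  'rV[T]_n (g_sigma_preimage coors) rV_set0 rV_setC rV_bigcup.

End measurable_rV.

Lemma measurable_coord d (T : measurableType d) n (i : 'I_n) :
  measurable_fun [set: 'rV[T]_n] (fun x : 'rV[T]_n => x ord0 i).
Proof.
move=> _ Y mY; rewrite setTI; apply: sub_sigma_algebra => /=.
rewrite -bigcup_seq/=; exists i => /=; first by rewrite mem_index_enum.
by exists Y => //; rewrite setTI.
Qed.

Lemma measurable_fun_coordP d1 d2 (T1 : measurableType d1)
    (T2 : measurableType d2) n (f : T1 -> 'rV[T2]_n) :
  measurable_fun [set: T1] f <->
  forall i, measurable_fun [set: T1] (fun x => f x ord0 i).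
Proof.
split=> [mf i|mf].
  exact: (measurableT_comp (@measurable_coord _ _ _ i) mf).
move=> _ A mA; rewrite setTI.
pose S := [set B : set 'rV[T2]_n | measurable (f @^-1` B)].
suff : g_sigma_preimage (fun (i : 'I_n) (x : 'rV[T2]_n) => x ord0 i) `<=` S.
  exact.
apply: smallest_sub.
  split.
  - by rewrite /S /= preimage_set0; exact: measurable0.
  - by move=> B mB; rewrite /S /= setTD -preimage_setC; exact: measurableC.
  - by move=> F mF; rewrite /S /= preimage_bigcup;
    apply: bigcup_measurable => k _; exact: mF.
move=> B; rewrite -bigcup_seq /= => -[i _ [C mC <-]].
rewrite /S /= setTI.
by have := mf i measurableT C mC; rewrite setTI.
Qed.

(* Lebesgue measure on R^n, as the n-fold product of lebesgue_measure: R^(n+1)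
   is identified with R * R^n by cons_rV. The type measurableTypeR R is R with
   the display on which lebesgue_measure is defined. *)
Section lebesgue_rV.
Context {R : realType}.

Definition cons_rV n (p : measurableTypeR R * 'rV[R]_n) : 'rV[R]_n.+1 :=
  \row_i if unlift ord0 i is Some j then p.2 ord0 j else p.1.

Definition uncons_rV n (x : 'rV[R]_n.+1) : measurableTypeR R * 'rV[R]_n :=
  (x ord0 ord0, \row_j x ord0 (lift ord0 j)).

Lemma cons_rVK n : cancel (@cons_rV n) (@uncons_rV n).
Proof.
case=> a x; congr pair; first by rewrite mxE unlift_none.
by apply/rowP => j; rewrite !mxE liftK.
Qed.

Lemma uncons_rVK n : cancel (@uncons_rV n) (@cons_rV n).
Proof.
move=> x; apply/rowP => i; rewrite mxE /=.
by case: unliftP => [j ->|->]; rewrite ?mxE.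
Qed.

Lemma measurable_cons_rV n :
  measurable_fun [set: measurableTypeR R * 'rV[R]_n] (@cons_rV n).
Proof.
apply/measurable_fun_coordP => i.
case: (unliftP ord0 i) => [j ->|->].
- rewrite (_ : (fun _ => _) = (fun x : 'rV[R]_n => x ord0 j) \o snd).
    exact: measurableT_comp (@measurable_coord _ R _ j) measurable_snd.
  by apply/funext => p /=; rewrite mxE liftK.
- rewrite (_ : (fun _ => _) = fst) //.
  by apply/funext => p /=; rewrite mxE unlift_none.
Qed.

Lemma measurable_uncons_rV n : measurable_fun [set: 'rV[R]_n.+1] (@uncons_rV n).
Proof.
apply: measurable_fun_pair => /=; first exact: (@measurable_coord _ R).
apply/measurable_fun_coordP => j.
rewrite (_ : (fun _ => _) = fun x : 'rV[R]_n.+1 => x ord0 (lift ord0 j)).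
  exact: measurable_coord.
by apply/funext => x; rewrite mxE.
Qed.

Section lebesgue_rVS.
Variables (n : nat) (mu : {sigma_finite_measure set 'rV[R]_n -> \bar R}).

Definition lebesgue_rVS : set 'rV[R]_n.+1 -> \bar R :=
  pushforward (product_measure1 (@lebesgue_measure R) mu) (@cons_rV n).

Let lebesgue_rVS0 : lebesgue_rVS set0 = 0%E.
Proof. by rewrite /lebesgue_rVS /pushforward preimage_set0 measure0. Qed.

Let lebesgue_rVS_ge0 A : (0 <= lebesgue_rVS A)%E.
Proof. by rewrite /lebesgue_rVS /pushforward; apply: measure_ge0. Qed.

Let lebesgue_rVS_sigma_additive : semi_sigma_additive lebesgue_rVS.
Proof.
have mcons A : measurable A -> measurable (@cons_rV n @^-1` A).
  move=> mA; rewrite -[X in measurable X]setTI.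
  exact: (@measurable_cons_rV n measurableT A mA).
move=> F mF tF mUF; rewrite /lebesgue_rVS /pushforward preimage_bigcup.
apply: (@measure_semi_sigma_additive _ _ _
    (product_measure1 (@lebesgue_measure R) mu)
    (fun k => @cons_rV n @^-1` F k)).
- by move=> k; exact: (mcons _ (mF k)).
- apply/trivIsetP => /= i j _ _ ij; rewrite -preimage_setI.
  by move/trivIsetP : tF => /(_ _ _ _ _ ij) ->//; rewrite preimage_set0.
- by rewrite -preimage_bigcup; exact: (mcons _ mUF).
Qed.

HB.instance Definition _ := isMeasure.Build _ _ _ lebesgue_rVS
  lebesgue_rVS0 lebesgue_rVS_ge0 lebesgue_rVS_sigma_additive.

Let lebesgue_rVS_sigma_finite : sigma_finite setT lebesgue_rVS.
Proof.
have /sigma_finiteP[F [UF ndF Foo]] := sigma_finiteT (@lebesgue_measure R).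
have /sigma_finiteP[G [UG ndG Goo]] := sigma_finiteT mu.
exists (fun k => @uncons_rV n @^-1` (F k `*` G k)).
  apply/esym; rewrite -preimage_bigcup -subTset => x _.
  have : (\bigcup_k F k) (uncons_rV x).1 by rewrite -UF.
  have : (\bigcup_k G k) (uncons_rV x).2 by rewrite -UG.
  move=> [j _ Gj] [i _ Fi]; exists (maxn i j) => //; split.
  - by move: Fi; exact/subsetPset/ndF/leq_maxl.
  - by move: Gj; exact/subsetPset/ndG/leq_maxr.
move=> k; have [mF Fk] := Foo k; have [mG Gk] := Goo k.
have mFG : measurable (F k `*` G k) by exact: measurableX.
split; first by rewrite -[X in measurable X]setTI; exact: measurable_uncons_rV.
rewrite /lebesgue_rVS /pushforward -comp_preimage.
rewrite (_ : _ \o _ = id); last first.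
  by apply/funext => p; rewrite /= cons_rVK.
by rewrite preimage_id product_measure1E// lte_mul_pinfty// ge0_fin_numE.
Qed.

HB.instance Definition _ := Measure_isSigmaFinite.Build _ _ _ lebesgue_rVS
  lebesgue_rVS_sigma_finite.

End lebesgue_rVS.

Fixpoint lebesgue_rV n : {sigma_finite_measure set 'rV[R]_n -> \bar R} :=
  if n is m.+1 then lebesgue_rVS (lebesgue_rV m)
  else dirac (0 : 'rV[R]_0).

End lebesgue_rV.

Lemma lebesgue_rV_box (R : realType) n (A : 'I_n -> set R) :
  (forall i, measurable (A i)) ->
  lebesgue_rV n [set x : 'rV[R]_n | forall i, A i (x ord0 i)] =
  (\prod_(i < n) lebesgue_measure (A i))%E.
Proof.
elim: n A => [|n IH] A mA.
  by rewrite big_ord0 /= diracE mem_set// => -[[]].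
rewrite big_ord_recl -(IH (fun i => A (lift ord0 i)))//.
set B := [set x : 'rV[R]_n | _].
have mB : measurable B.
  rewrite (_ : B = \bigcap_(i in [set: 'I_n])
      ((fun x : 'rV[R]_n => x ord0 i) @^-1` A (lift ord0 i))); last first.
    by apply/seteqP; split => x /= Bx => [i _|i]; [exact: Bx|exact: (Bx i)].
  apply: fin_bigcap_measurable => // i _.
  by rewrite -[X in measurable X]setTI; exact: (@measurable_coord _ R).
rewrite /= /lebesgue_rVS /pushforward.
rewrite (_ : _ @^-1` _ = A ord0 `*` B); first by rewrite product_measure1E//; exact: mA.
apply/seteqP; split => -[a x] /=.
- move=> Aax; split => [|i]; first by have := Aax ord0; rewrite mxE unlift_none.
  by have := Aax (lift ord0 i); rewrite mxE liftK.
- by move=> [Aa Bx] i; rewrite mxE; case: unliftP => [j ->|->] /=.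
Qed.

(* In what follows the ambient space is R^(n+1), with points x : 'rV[R]_n.+1;
   its first coordinate is x ord0 ord0 and its last one x ord0 ord_max. *)
Section fractional_operators.
Context {R : realType} {n : nat}.
Implicit Types (alpha theta lambda : R) (u : 'rV[R]_n.+1 -> R).
Implicit Types (x : 'rV[R]_n.+1).

(* The norm `|x| of the library is the sup norm. *)
Definition enorm x : R := Num.sqrt (\sum_i x ord0 i ^+ 2).

Definition upper_half_space : set 'rV[R]_n.+1 := [set x | 0 < x ord0 ord_max].

(* C_{n,alpha} = (\int (1 - cos z_1) / |z|^{n+alpha} dz)^{-1} is the constant
   for which the fractional Laplacian has Fourier symbol |xi|^alpha. *)
Definition frac_const alpha : R :=
  (\int[lebesgue_rV n.+1]_z
     ((1 - cos (z ord0 ord0)) / enorm z `^ (n.+1%:R + alpha)))^-1.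

Definition frac_laplacian alpha u x : R :=
  frac_const alpha *
  lim ((fun eps : R => \int[lebesgue_rV n.+1]_(y in [set y | eps <= enorm (x - y)])
          ((u x - u y) / enorm (x - y) `^ (n.+1%:R + alpha))) @ 0^'+).

Definition nonlocal_normal alpha u x : R :=
  frac_const alpha *
  \int[lebesgue_rV n.+1]_(y in upper_half_space)
     ((u x - u y) / enorm (x - y) `^ (n.+1%:R + alpha)).

Definition in_L alpha u : Prop :=
  measurable_fun setT u /\
  (\int[lebesgue_rV n.+1]_x
     (`|u x| / (1 + enorm x `^ (n.+1%:R + alpha)))%:E < +oo)%E.

(* For theta > 0 the Holder bound makes the partial derivatives continuous. *)
Definition C1_holder_loc theta u : Prop :=
  (forall x, differentiable u x) /\
  forall (i : 'I_n.+1) (K : set 'rV[R]_n.+1), compact K ->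
    exists M : R, forall x y, K x -> K y ->
      `|'D_(delta_mx ord0 i) u x - 'D_(delta_mx ord0 i) u y|
        <= M * enorm (x - y) `^ theta.

Definition vanishes_at_infty u : Prop :=
  forall eps : R, 0 < eps ->
    exists M : R, forall x, M < enorm x -> `|u x| < eps.

Definition half_space lambda : set 'rV[R]_n.+1 :=
  [set x | x ord0 ord0 < lambda].

Definition slab lambda ell : set 'rV[R]_n.+1 :=
  [set x | half_space lambda x /\ lambda - ell < x ord0 ord0 < lambda].

Definition reflect_x1 lambda x : 'rV[R]_n.+1 :=
  \row_i if i == ord0 then 2 * lambda - x ord0 ord0 else x ord0 i.

Definition reflect_diff u lambda x : R := u (reflect_x1 lambda x) - u x.

End fractional_operators.

Section quadrant.
Context {R : realType}.
Implicit Types f : R -> R -> R.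

Definition partial1 f (a b : R) : R := derive1 (fun s => f s b) a.
Definition partial2 f (a b : R) : R := derive1 (f a) b.

Definition quadrant : set (R * R) := [set p | 0 <= p.1 /\ 0 <= p.2].

(* C^1 up to the boundary: f is continuous on the closed quadrant and its
   partial derivatives on the open quadrant extend continuously to the closed
   one. The values of f outside the closed quadrant play no role. *)
Definition C1_quadrant f : Prop :=
  {within quadrant, continuous (fun p : R * R => f p.1 p.2)} /\
  exists f1 f2 : R * R -> R,
    [/\ {within quadrant, continuous f1},
        {within quadrant, continuous f2} &
        forall a b : R, 0 < a -> 0 < b ->
          is_derive a (1 : R) (fun s => f s b) (f1 (a, b)) /\
          is_derive b (1 : R) (f a) (f2 (a, b))].

End quadrant.

(* Main.v *)
(* Let x be a negative minimum point of U = U_lambda in the slab and put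
   d = lambda - x_1. Let L be the fractional Laplacian or the nonlocal normal
   derivative. Averaging the integrand of (L u)(x^lambda) - (L u)(x) with its
   reflection, the antisymmetry and the minimality of U give
     (L u)(x^lambda) - (L u)(x) <= U(x) * c * |E|
   for any set E beyond the hyperplane on which the kernel is at least c. A cube
   of side d makes the right-hand side a multiple of U(x) d^-alpha for the
   fractional Laplacian; for the normal derivative it is merely negative.
   If x_n >= 0, the mean value theorem for f yields f_v V <= (c d^-alpha - K) U,
   where K bounds the partial derivatives of f on the range of (u, v), so that
   V < mu U as soon as d is small. On x_n = 0, where no equation is assumed, it
   holds by continuity: the fractional Laplacian is an absolutely convergent
   integral of second differences, dominated locally uniformly thanks to the
   C^{1,theta} bound.
   If x_n < 0, then h_u U + h_v V < 0 at a point of a segment, and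
   - h_u >= mu h_v forces V < mu U. *)
Require Import Defs.
From HB Require Import structures.
From mathcomp Require Import all_boot all_order all_algebra.
From mathcomp Require Import all_classical all_reals all_analysis.
From mathcomp Require Import measurable_realfun.
From mathcomp Require Import ring lra.

Set Implicit Arguments.
Unset Strict Implicit.
Unset Printing Implicit Defensive.

Import Order.TTheory GRing.Theory Num.Theory.
Import numFieldNormedType.Exports.

Local Open Scope classical_set_scope.
Local Open Scope ring_scope.

(** * Measure-preserving maps *)

Section measure_preserving_maps.
Context {d} {T : measurableType d} {R : realType}.
Variable mu : {measure set T -> \bar R}.

Definition measure_preserving (phi : T -> T) : Prop :=
  measurable_fun [set: T] phi /\
  forall A, measurable A -> mu (phi @^-1` A) = mu A.

Lemma measurable_preimage (phi : T -> T) (D : set T) :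
  measure_preserving phi -> measurable D -> measurable (phi @^-1` D).
Proof. by move=> [mphi _] mD; rewrite -[X in measurable X]setTI; exact: mphi. Qed.

Lemma preserving_integrable (phi : T -> T) (D : set T) (f : T -> \bar R) :
  measure_preserving phi -> measurable D -> measurable_fun [set: T] f ->
  mu.-integrable D f -> mu.-integrable (phi @^-1` D) (f \o phi).
Proof.
move=> mp mD mf /integrableP[_ fint]; have [mphi muphi] := mp.
have mfphi : measurable_fun setT (f \o phi) by exact: measurableT_comp.
apply/integrableP; split; first exact: measurable_funTS.
have mabs : measurable_fun [set: T] (abse \o f) by exact: measurableT_comp.
apply: le_lt_trans fint; rewrite le_eqVlt; apply/orP; left; apply/eqP.
transitivity (\int[pushforward mu phi]_(x in D) `|f x|)%E.
  by rewrite (ge0_integral_pushforward mphi)//; exact: measurable_funTS.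
by apply: eq_measure_integral => A mA _; exact: muphi.
Qed.

(** Change of variables: the push-forward of [mu] under [phi] agrees with [mu] on measurable
    sets. *)
Lemma preserving_Rintegral (phi : T -> T) (D : set T) (f : T -> R) :
  measure_preserving phi -> measurable D -> measurable_fun [set: T] f ->
  mu.-integrable D (EFin \o f) ->
  \int[mu]_(x in phi @^-1` D) f (phi x) = \int[mu]_(x in D) f x.
Proof.
move=> mp mD mf fint; have [mphi muphi] := mp.
have mfE : measurable_fun setT (EFin \o f) by exact/measurable_EFinP.
rewrite /Rintegral; congr fine.
transitivity (\int[pushforward mu phi]_(x in D) (f x)%:E)%E.
  by rewrite (integral_pushforward mphi mfE)//; exact: preserving_integrable.
by apply: eq_measure_integral => A mA _; exact: muphi.
Qed.

End measure_preserving_maps.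

(** By induction on the dimension: read through [cons_rV], the map acts separately on the first
    coordinate and on the others, so the push-forward of the product measure has the right value on
    rectangles, which determine it. *)
Lemma preserving_coordinatewise (R : realType) n (t : 'I_n -> R -> R) :
  (forall i, measure_preserving (@lebesgue_measure R) (t i)) ->
  measure_preserving (lebesgue_rV n)
    (fun x : 'rV[R]_n => \row_i t i (x ord0 i)).
Proof.
move=> mpt; split.
  apply/measurable_fun_coordP => i.
  rewrite (_ : (fun _ => _) = t i \o (fun x : 'rV[R]_n => x ord0 i)).
    by apply: measurableT_comp; [exact: (mpt i).1|exact: measurable_coord].
  by apply/funext => x /=; rewrite mxE.
elim: n => [|n IH] in t mpt *.
  move=> A mA; congr (_ _); apply/seteqP; split=> x /=;
    by rewrite [\row_i _](_ : _ = x)//; apply/rowP => -[].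
move=> A mA /=; rewrite /lebesgue_rVS /pushforward.
pose t' i := t (lift ord0 i).
have mt0 : measurable_fun setT (t ord0 : measurableTypeR R -> _) := (mpt ord0).1.
have mt' : measurable_fun [set: 'rV[R]_n] (fun x : 'rV[R]_n => \row_i t' i (x ord0 i) : 'rV[R]_n).
  apply/measurable_fun_coordP => i.
  rewrite (_ : (fun _ => _) = t' i \o (fun x : 'rV[R]_n => x ord0 i)).
    by apply: measurableT_comp; [exact: (mpt _).1|exact: measurable_coord].
  by apply/funext => x /=; rewrite mxE.
pose q (p : measurableTypeR R * 'rV[R]_n) : measurableTypeR R * 'rV[R]_n :=
  (t ord0 p.1, \row_i t' i (p.2 ord0 i)).
have mq : measurable_fun setT q.
  apply: measurable_fun_pair => /=.
    by apply: (measurableT_comp mt0); exact: measurable_fst.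
  by apply: (measurableT_comp mt'); exact: measurable_snd.
rewrite (_ : _ @^-1` (_ @^-1` A) = q @^-1` (@cons_rV R n @^-1` A)); last first.
  have E p : \row_i t i (cons_rV p ord0 i) = cons_rV (q p).
    apply/rowP => i; rewrite !mxE.
    by case: unliftP => [j ->|->]; rewrite ?mxE.
  by apply/seteqP; split=> p /=; rewrite E.
set B := _ @^-1` A.
have mB : measurable B.
  by rewrite -[X in measurable X]setTI; exact: (@measurable_cons_rV R n measurableT A mA).
apply/esym.
transitivity (pushforward (product_measure1 (@lebesgue_measure R) (lebesgue_rV n)) q B); last by [].
pose mq_pack : {mfun _ >-> _} := HB.pack q (isMeasurableFun.Build _ _ _ _ _ mq).
apply: (@product_measure_unique _ _ _ _ _ (@lebesgue_measure R) (lebesgue_rV n)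
  (pushforward (product_measure1 (@lebesgue_measure R) (lebesgue_rV n)) mq_pack)) => // C D mC mD.
change (product_measure1 (@lebesgue_measure R) (lebesgue_rV n) ((t ord0 @^-1` C) `*`
   ((fun x : 'rV[R]_n => \row_i t' i (x ord0 i) : 'rV[R]_n) @^-1` D)) =
   (lebesgue_measure C * lebesgue_rV n D)%E).
rewrite product_measure1E; last 2 first.
- by rewrite -[X in measurable X]setTI; exact: mt0.
- by rewrite -[X in measurable X]setTI; exact: mt'.
by rewrite (mpt ord0).2// IH// => i; exact: mpt.
Qed.

(** * Translations and reflections preserve Lebesgue measure *)

Section lebesgue_isometries.
Context {R : realType}.

(** Translations keep the length of half-open intervals, and these lengths determine Lebesgue
    measure. *)
Lemma preserving_addl (a : R) :
  measure_preserving (@lebesgue_measure R) (fun t => a + t).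
Proof.
have mt : measurable_fun setT ((fun t => a + t) : measurableTypeR R -> measurableTypeR R).
  by apply: measurable_funD.
split => // A mA.
pose mt_pack : {mfun measurableTypeR R >-> measurableTypeR R} :=
  HB.pack ((fun t => a + t) : measurableTypeR R -> measurableTypeR R)
  (isMeasurableFun.Build _ _ _ _ _ mt).
apply/esym/(@lebesgue_measure_unique R (pushforward (@lebesgue_measure R) mt_pack))
  => // _ [[b c]] _ <-.
transitivity (lebesgue_measure `](b - a), (c - a)]%classic).
  by rewrite !lebesgue_measure_itv/= !lte_fin ltrD2r -!EFinB opprB addrA subrK.
congr lebesgue_measure.
by apply/seteqP; split => x /=; rewrite !in_itv/= ltrBlDl lerBrDl.
Qed.

Lemma preserving_subl (a : R) :
  measure_preserving (@lebesgue_measure R) (fun t => a - t).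
Proof.
have [m1 p1] := preserving_addl a.
have mN : measurable_fun setT (-%R : R -> measurableTypeR R) by apply: measurable_funN.
split.
  exact: (measurableT_comp m1 mN).
move=> A mA; rewrite -[RHS]p1//.
rewrite -[RHS]lebesgue_measureN//.
by rewrite -[X in measurable X]setTI; exact: m1.
Qed.

Lemma preserving_translate n (a : 'rV[R]_n) :
  measure_preserving (lebesgue_rV n) (fun x => a + x).
Proof.
rewrite (_ : (fun _ => _) = (fun x : 'rV[R]_n => \row_i (a ord0 i + x ord0 i))).
  by apply: (@preserving_coordinatewise _ _ (fun i t => a ord0 i + t)) => i; exact: preserving_addl.
by apply/funext => x; apply/rowP => i; rewrite !mxE.
Qed.

Lemma preserving_opp n : measure_preserving (lebesgue_rV n) (-%R : 'rV[R]_n -> _).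
Proof.
rewrite (_ : -%R = (fun x : 'rV[R]_n => \row_i (0 - x ord0 i))).
  by apply: (@preserving_coordinatewise _ _ (fun _ t => 0 - t)) => i; exact: preserving_subl.
by apply/funext => x; apply/rowP => i; rewrite !mxE sub0r.
Qed.

Lemma preserving_reflect n (lambda : R) :
  measure_preserving (lebesgue_rV n.+1) (@reflect_x1 R n lambda).
Proof.
(* The fixed coordinates are read as translations by 0, so every coordinate map is one of the two
   kinds treated above. *)
rewrite (_ : reflect_x1 _ = (fun x : 'rV[R]_n.+1 => \row_i
    (if i == ord0 then fun t => 2 * lambda - t else fun t => 0 + t) (x ord0 i))).
  apply: (@preserving_coordinatewise _ _
    (fun i => if i == ord0 then fun t => 2 * lambda - t else fun t => 0 + t)) => i.
  case: ifP => _; [exact: preserving_subl|exact: preserving_addl].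
apply/funext => x; apply/rowP => i; rewrite !mxE.
by case: ifP => [/eqP ->|]//; rewrite add0r.
Qed.

End lebesgue_isometries.

(** * The kernel of the fractional Laplacian *)

Section euclidean_norm.
Context {R : realType} {n : nat}.
Implicit Types x y z : 'rV[R]_n.+1.

Lemma enorm_ge0 x : 0 <= enorm x.
Proof. exact: sqrtr_ge0. Qed.

Lemma sqr_enorm x : enorm x ^+ 2 = \sum_i x ord0 i ^+ 2.
Proof. by rewrite sqr_sqrtr// sumr_ge0// => i _; exact: sqr_ge0. Qed.

Lemma coord_le_enorm x i : `|x ord0 i| <= enorm x.
Proof.
rewrite -(@ler_pXn2r _ 2)// ?nnegrE ?enorm_ge0//.
rewrite sqr_enorm real_normK ?num_real// (bigD1 i)//= lerDl.
by apply: sumr_ge0 => j _; exact: sqr_ge0.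
Qed.

Lemma enorm_le_coord x (r : R) : 0 <= r -> (forall i, `|x ord0 i| <= r) ->
  enorm x <= n.+1%:R * r.
Proof.
move=> r0 xr; rewrite -(@ler_pXn2r _ 2)// ?nnegrE ?enorm_ge0 ?mulr_ge0//.
rewrite sqr_enorm; apply: (@le_trans _ _ (\sum_(i < n.+1) r ^+ 2)).
  apply: ler_sum => i _; rewrite -[x _ _ ^+ 2]real_normK ?num_real//.
  by rewrite ler_pXn2r ?nnegrE.
rewrite sumr_const card_ord exprMn -[leLHS]mulr_natl ler_wpM2r ?sqr_ge0//.
by rewrite -natrX ler_nat expnS expn1 leq_pmulr.
Qed.

Lemma enormN x : enorm (- x) = enorm x.
Proof. by congr Num.sqrt; apply: eq_bigr => i _; rewrite mxE sqrrN. Qed.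

Lemma enorm0 : enorm (0 : 'rV[R]_n.+1) = 0.
Proof.
rewrite /enorm big1 ?sqrtr0// => i _; by rewrite mxE expr0n.
Qed.

Lemma enormZ (a : R) x : enorm (a *: x) = `|a| * enorm x.
Proof.
rewrite /enorm -sqrtr_sqr -sqrtrM ?sqr_ge0//; congr Num.sqrt.
by rewrite mulr_sumr; apply: eq_bigr => i _; rewrite mxE exprMn.
Qed.

Lemma norm_le_enorm x : `|x| <= enorm x.
Proof.
rewrite [`|x|]mx_normrE; apply: bigmax_le => [|[i j] _]; first exact: enorm_ge0.
by rewrite ord1; exact: coord_le_enorm.
Qed.

Lemma enorm_le_norm x : enorm x <= n.+1%:R * `|x|.
Proof.
apply: enorm_le_coord => // i; rewrite [`|x|]mx_normrE.
exact: (le_bigmax _ (fun ij => `|x ij.1 ij.2|) (ord0, i)).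
Qed.

Lemma measurable_enorm : measurable_fun [set: 'rV[R]_n.+1] enorm.
Proof.
apply: (measurableT_comp (continuous_measurable_fun (@sqrt_continuous R))).
by apply: measurable_sum => i; apply: measurable_funX; exact: measurable_coord.
Qed.

(* ker alpha 0 = 0, as powR 0 p = 0 for p <> 0 and 0^-1 = 0. *)
Definition ker (alpha : R) z : R := (enorm z `^ (n.+1%:R + alpha))^-1.

Lemma ker_ge0 alpha z : 0 <= ker alpha z.
Proof. by rewrite invr_ge0 powR_ge0. Qed.

Lemma kerN alpha z : ker alpha (- z) = ker alpha z.
Proof. by rewrite /ker enormN. Qed.

Lemma measurable_ker alpha : measurable_fun [set: 'rV[R]_n.+1] (ker alpha).
Proof.
rewrite (_ : ker alpha = ((@powR R)^~ (- (n.+1%:R + alpha))) \o enorm).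
  by apply: measurableT_comp; [exact: measurable_powR|exact: measurable_enorm].
by apply/funext => z /=; rewrite powRN.
Qed.

Lemma ker_le alpha y z : 0 < alpha -> 0 < enorm y -> enorm y <= enorm z ->
  ker alpha z <= ker alpha y.
Proof.
move=> a0 y0 yz; have p0 : 0 < n.+1%:R + alpha by rewrite addr_gt0.
rewrite lef_pV2 ?posrE ?powR_gt0//; last exact: lt_le_trans yz.
by rewrite ge0_ler_powR ?nnegrE ?enorm_ge0// ltW.
Qed.

Definition cube (r : R) : set 'rV[R]_n.+1 :=
  [set z | forall i, `|z ord0 i| <= r].

Lemma measurable_cube r : measurable (cube r).
Proof.
rewrite (_ : cube r = \bigcap_(i in [set: 'I_n.+1])
    ((fun z : 'rV[R]_n.+1 => z ord0 i) @^-1` `[-r, r]%classic)).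
  apply: fin_bigcap_measurable => // i _.
  rewrite -[X in measurable X]setTI.
  by apply: (@measurable_coord _ R) => //; exact: measurable_itv.
apply/seteqP; split => z /= h.
  by move=> i _; have := h i; rewrite ler_norml.
by move=> i; rewrite ler_norml; have := h i I; rewrite /= in_itv/=.
Qed.

Lemma lebesgue_cube r : 0 <= r ->
  lebesgue_rV n.+1 (cube r) = ((2 * r) ^+ n.+1)%:E.
Proof.
move=> r0; rewrite (_ : cube r =
    [set z : 'rV[R]_n.+1 | forall i, `[-r, r]%classic (z ord0 i)]); last first.
  by apply/seteqP; split => z /= h i; have := h i; rewrite /= in_itv/= ler_norml.
rewrite (@lebesgue_rV_box R n.+1 (fun=> `[-r, r]%classic))//.
rewrite (eq_bigr (fun=> (2 * r)%:E)); last first.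
  move=> i _; rewrite lebesgue_measure_itv/= lte_fin.
  case: ltP => rr; first by rewrite -EFinB opprK mulr_natl mulr2n.
  suff -> : r = 0 by rewrite mulr0.
  by lra.
by rewrite big_const_ord; elim: n.+1 => //= k ->; rewrite -EFinM exprS.
Qed.

(** The sum over k of [c k] times the indicator of [cube (rho k)] dominates [phi]; integrated term
    by term it is at most a geometric series. *)
Lemma integrable_cube_series (phi : 'rV[R]_n.+1 -> R) (c rho : nat -> R) (C q : R) :
  measurable_fun setT phi -> (forall z, 0 <= phi z) ->
  (forall k, 0 <= c k) -> (forall k, 0 <= rho k) -> 0 <= C -> 0 < q < 1 ->
  (forall k, c k * (2 * rho k) ^+ n.+1 <= C * q ^+ k) ->
  (forall z, 0 < phi z -> exists k, phi z <= c k /\ cube (rho k) z) ->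
  (lebesgue_rV n.+1).-integrable setT (EFin \o phi).
Proof.
move=> mphi phi0 c0 rho0 C0 /andP[q0 q1] cq phic.
pose F k (z : 'rV[R]_n.+1) := (c k * \1_(cube (rho k)) z)%:E.
have F0 k z : (0 <= F k z)%E by rewrite lee_fin mulr_ge0.
have mF k : measurable_fun setT (F k).
  apply/measurable_EFinP/measurable_funM => //.
  by apply: measurable_indic; exact: measurable_cube.
apply/integrableP; split; first exact/measurable_EFinP.
apply: (@le_lt_trans _ _ (\int[lebesgue_rV n.+1]_z (\sum_(0 <= k <oo) F k z))%E).
  apply: ge0_le_integral => //.
  - by apply/measurable_EFinP; exact: measurableT_comp.
  - by apply: (ge0_emeasurable_sum (P := xpredT)) => // k z _ _; exact: F0.
  move=> z _ /=; rewrite ger0_norm//.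
  have [z0|z0] := eqVneq (phi z) 0.
    by rewrite z0; exact: nneseries_ge0.
  have /phic [k [zk zcube]] : 0 < phi z by rewrite lt_neqAle eq_sym z0 phi0.
  (* The k-th term alone bounds [phi z], and the partial sum of length [k.+1] is the first to
     contain it. *)
  apply: (@le_trans _ _ (\sum_(0 <= i < k.+1) F i z)%E); last first.
    by apply: nneseries_lim_ge => i _ _; exact: F0.
  rewrite big_nat_recr//= -[leLHS]add0e; apply: leeD.
    by apply: sume_ge0 => i _; exact: F0.
  by rewrite lee_fin indicE mem_set// mulr1.
rewrite integral_nneseries//.
apply: (@le_lt_trans _ _ (C / (1 - q))%:E); last by rewrite ltry.
apply: lime_le.
  by apply: is_cvg_ereal_nneg_natsum => k _; apply: integral_ge0 => z _; exact: F0.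
near=> N.
apply: (@le_trans _ _ (\sum_(0 <= k < N) (C * q ^+ k)%:E)%E).
  apply: lee_sum => k _.
  rewrite /F; under eq_integral do rewrite EFinM.
  rewrite ge0_integralZl//; last 2 first.
  - apply/measurable_EFinP/measurable_indic; exact: measurable_cube.
  - by rewrite lee_fin.
  rewrite integral_indic//; last exact: measurable_cube.
  rewrite setIT [X in (_ * X)%E](_ : _ = ((2 * rho k) ^+ n.+1)%:E) ?lee_fin//.
  exact: lebesgue_cube.
rewrite sumEFin lee_fin.
by have := @geometric_le_lim R N C q C0 q0; rewrite /series /= gtr0_norm//; exact.
Unshelve. all: by end_near. Qed.

Lemma dyadic_bracket (x : R) : 1 <= x -> exists k : nat, 2 ^+ k <= x < 2 ^+ k.+1.
Proof.
move=> x1.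
have ex : exists k : nat, x < 2 ^+ k.+1.
  have x0 : 0 <= x by exact: le_trans x1.
  exists (Num.bound x); apply: (lt_trans (archi_boundP x0)).
  by rewrite -natrX ltr_nat (ltn_trans (ltn_expl _ (isT : 1 < 2)%N))// ltn_exp2l.
(* The least such [k] works: at 0 the lower bound is [1 <= x], and otherwise it is the failure at
   the predecessor. *)
case: (ex_minnP ex) => -[|k] xk kmin; first by exists 0%N; rewrite expr0 x1.
exists k.+1; rewrite xk andbT leNgt; apply/negP => /kmin.
by rewrite ltnn.
Qed.

(* On 2^-(k+1) <= |z| <= 2^-k and on 2^k <= |z| < 2^(k+1) the function is at most
   the k-th coefficient of the corresponding series of cubes. *)
Lemma integrable_min_ker (alpha s : R) : 0 < alpha < s ->
  (lebesgue_rV n.+1).-integrable setT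
    (EFin \o (fun z => Num.min 1 (enorm z `^ s) * ker alpha z)).
Proof.
move=> /andP[a0 sa].
set G := fun z => _; set p := n.+1%:R + alpha.
have s0 : 0 < s by exact: lt_trans sa.
have p0 : 0 < p by rewrite addr_gt0.
have G0 z : 0 <= G z.
  by rewrite mulr_ge0 ?ker_ge0// le_min ler01 powR_ge0.
have mG : measurable_fun setT G.
  apply: measurable_funM; last exact: measurable_ker.
  apply: measurable_minr => //.
  by apply: (measurableT_comp (measurable_powR s)); exact: measurable_enorm.
pose D := [set z : 'rV[R]_n.+1 | enorm z <= 1].
have mD : measurable D.
  by rewrite -[X in measurable X]setTI; apply: measurable_fun_le => //; exact: measurable_enorm.
(* [G] vanishes at the origin, so the cubes have to be found for nonzero points only. *)
have Gne0 z : 0 < G z -> 0 < enorm z.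
  move=> Gz; rewrite lt_neqAle enorm_ge0 andbT eq_sym; apply/eqP => z0.
  by move: Gz; rewrite /G z0 powR0 ?gt_eqF// minElt ltr10 mul0r ltxx.
have bin (k : nat) (x : R) : (2 ^+ k) `^ x = (2 `^ x) ^+ k.
  rewrite -powR_mulrn// -powRrM mulrC powRrM powR_mulrn ?powR_ge0//.
have binV (k : nat) (x : R) : (2 ^- k) `^ x = ((2 `^ x) ^+ k)^-1.
  by rewrite -bin -powRN -mulN1r powRrM powR_inv1 ?exprn_ge0.
have lt1 (t : R) : 0 < t -> 0 < (2 : R) `^ (- t) < 1.
  move=> t0; rewrite powR_gt0//= powRN invf_lt1 ?powR_gt0//.
  have : (1 : R) `^ t < 2 `^ t by rewrite gt0_ltr_powR ?nnegrE ?ltr1n.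
  by rewrite powR1.
pose A : R := 2 `^ alpha; pose w : R := 2 ^+ n.+1; pose B : R := 2 `^ s.
have A0 : 0 < A by rewrite powR_gt0.
have B0 : 0 < B by rewrite powR_gt0.
have w0 : 0 < w by rewrite exprn_gt0.
have pE : 2 `^ p = w * A by rewrite powRD ?pnatr_eq0 ?implybT// powR_mulrn.
have -> : G = (fun z => G z * \1_D z) \+ (fun z => G z * \1_(~` D) z).
  apply/funext => z /=; rewrite -mulrDr !indicE in_setC.
  by case: (z \in D); rewrite ?addr0 ?add0r mulr1.
rewrite (_ : EFin \o _ = (EFin \o (fun z => G z * \1_D z)) \+
   (EFin \o (fun z => G z * \1_(~` D) z)))//.
apply: integrableD => //.
(* Unit ball: on the k-th shell the minimum is at most 2^(-ks) and the kernel at most 2^((k+1)p).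
   Times the volume of the cube this is a geometric sequence of ratio 2^(alpha-s). *)
- apply: (@integrable_cube_series _ (fun k => (2 ^- k) `^ s / (2 ^- k.+1) `^ p)
    (fun k => 2 ^- k) (2 `^ p * 2 ^+ n.+1) (2 `^ (- (s - alpha)))).
  + apply: measurable_funM => //; exact: measurable_indic.
  + by move=> z; rewrite mulr_ge0.
  + by move=> k; rewrite divr_ge0 ?powR_ge0.
  + by move=> k; rewrite invr_ge0 exprn_ge0.
  + by rewrite mulr_ge0 ?powR_ge0 ?exprn_ge0.
  + by apply: lt1; rewrite subr_gt0.
  + move=> k; rewrite !binV pE -/B -/w opprB powRB ?pnatr_eq0 ?implybT// -/A -/B.
    rewrite [(2 * _) ^+ _]exprMn exprVn -exprM [(k * _)%N]mulnC exprM -/w invrK.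
    rewrite le_eqVlt; apply/orP; left; apply/eqP; rewrite !exprMn exprVn !exprS.
    by field; rewrite !expf_neq0 ?gt_eqF.
  + move=> z; rewrite indicE; case: (boolP (z \in D)); last by rewrite mulr0 ltxx.
    rewrite inE mulr1 /D/= => z1 Gz; have z0 := Gne0 _ Gz.
    have /dyadic_bracket[k /andP[k1 k2]] : 1 <= (enorm z)^-1 by rewrite invf_ge1.
    have zk : enorm z <= 2 ^- k.
      by rewrite -[enorm z]invrK lef_pV2 ?posrE ?exprn_gt0 ?invr_gt0.
    have kz : 2 ^- k.+1 <= enorm z.
      by rewrite -[enorm z]invrK lef_pV2 ?posrE ?exprn_gt0 ?invr_gt0// ltW.
    exists k; split; last by move=> i; exact: le_trans (coord_le_enorm _ _) zk.
    rewrite ler_pM ?ker_ge0 ?le_min ?ler01 ?powR_ge0//.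
      rewrite ge_min; apply/orP; right.
      by rewrite ge0_ler_powR ?nnegrE ?enorm_ge0 ?invr_ge0 ?exprn_ge0// ltW.
    rewrite lef_pV2 ?posrE ?powR_gt0 ?invr_gt0 ?exprn_gt0//.
    by rewrite ge0_ler_powR ?nnegrE ?enorm_ge0 ?invr_ge0 ?exprn_ge0// ltW.
(* Outside the unit ball the minimum is at most 1, and the coefficient times the volume has ratio
   2^(-alpha). *)
- apply: (@integrable_cube_series _ (fun k => ((2 ^+ k) `^ p)^-1)
    (fun k => 2 ^+ k.+1) (w ^+ 2) (2 `^ (- alpha))).
  + apply: measurable_funM => //; apply: measurable_indic; exact: measurableC.
  + by move=> z; rewrite mulr_ge0.
  + by move=> k; rewrite invr_ge0 powR_ge0.
  + by move=> k; rewrite exprn_ge0.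
  + by rewrite exprn_ge0// ltW.
  + exact: lt1.
  + move=> k; rewrite !bin pE powRN -/A.
    rewrite [(2 * _) ^+ _]exprMn -exprM [(k.+1 * _)%N]mulnC exprM -/w.
    rewrite le_eqVlt; apply/orP; left; apply/eqP; rewrite !exprMn exprVn !exprS.
    by field; rewrite !expf_neq0 ?gt_eqF.
  + move=> z; rewrite indicE in_setC; case: (boolP (z \in D)) => /=; first by rewrite mulr0 ltxx.
    rewrite notin_setE mulr1 /D/= => /negP; rewrite -ltNge => z1 Gz; have z0 := Gne0 _ Gz.
    have /dyadic_bracket[k /andP[k1 k2]] := ltW z1.
    exists k; split; last first.
      by move=> i; exact: le_trans (coord_le_enorm _ _) (ltW k2).
    rewrite -[leRHS]mul1r ler_pM ?ker_ge0 ?le_min ?ler01 ?powR_ge0// ?ge_min ?lexx//.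
    rewrite lef_pV2 ?posrE ?powR_gt0 ?exprn_gt0//.
    by rewrite ge0_ler_powR ?nnegrE ?enorm_ge0 ?exprn_ge0// ltW.
Qed.

End euclidean_norm.

(** Two applications of the mean value theorem: sin c <= c, then 1 - cos r = r sin e with 0 <= e <=
    r. It makes the integral that defines [frac_const] converge at the origin. *)
Lemma one_sub_cos_le (R : realType) (t : R) : 1 - cos t <= t ^+ 2.
Proof.
rewrite -cos_norm -[t ^+ 2]real_normK ?num_real//; set r := `|t|.
have r0 : 0 <= r by rewrite normr_ge0.
have sin_le c : 0 <= c -> sin c <= c :> R.
  move=> c0; have [|e _] := @MVT_segment R sin cos 0 c c0 (fun x _ => is_derive_sin x).
    by apply: continuous_subspaceT; exact: continuous_sin.
  rewrite sin0 !subr0 => ->; rewrite -[leRHS]mul1r ler_wpM2r//; exact: cos_le1.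
have [|e] := @MVT_segment R cos (fun x => - sin x) 0 r r0 (fun x _ => is_derive_cos x).
  by apply: continuous_subspaceT; exact: continuous_cos.
rewrite in_itv/= => /andP[e0 er]; rewrite cos0 !subr0 => h.
rewrite -opprB h mulNr opprK expr2 ler_wpM2r//.
by apply: le_trans er; exact: sin_le.
Qed.

(** * Integrability against the kernel, positivity of the constant *)

Section kernel_integrals.
Context {R : realType} {n : nat}.
Local Notation V := 'rV[R]_n.+1.
Local Notation mu := (lebesgue_rV n.+1).
Implicit Types (x y z : V) (alpha : R) (A E : set V).

Definition box (a : 'I_n.+1 -> R) (r : R) : set V :=
  [set y | forall i, a i < y ord0 i < a i + r].

Lemma measurable_box a r : measurable (box a r).
Proof.
rewrite (_ : box a r = \bigcap_(i in [set: 'I_n.+1])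
    ((fun z : V => z ord0 i) @^-1` `]a i, a i + r[%classic)).
  apply: fin_bigcap_measurable => // i _.
  rewrite -[X in measurable X]setTI.
  by apply: (@measurable_coord _ R) => //; exact: measurable_itv.
apply/seteqP; split => z /= h.
  by move=> i _; exact: h.
by move=> i; have := h i I; rewrite /= in_itv/=.
Qed.

Lemma lebesgue_box a r : 0 < r ->
  (mu : {measure set V -> \bar R}) (box a r) = (r ^+ n.+1)%:E.
Proof.
move=> r0; rewrite (_ : box a r =
    [set z : V | forall i, `]a i, a i + r[%classic (z ord0 i)]); last first.
  by apply/seteqP; split => z /= h i; have := h i; rewrite /= in_itv/=.
rewrite [LHS](_ : _ = (\prod_(i < n.+1) lebesgue_measure `]a i, (a i + r)%R[%classic)%E); last first.
  exact: (@lebesgue_rV_box R n.+1 (fun i => `]a i, a i + r[%classic)).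
rewrite (eq_bigr (fun=> r%:E)); last first.
  by move=> i _; rewrite lebesgue_measure_itv/= lte_fin ltrDl r0 -EFinB addrAC subrr add0r.
by rewrite big_const_ord; elim: n.+1 => //= k ->; rewrite -EFinM exprS.
Qed.

Lemma integrable_mul_ker (alpha s C : R) (phi : V -> R) : 0 < alpha < s ->
  measurable_fun setT phi ->
  (forall z, `|phi z| <= C * Num.min 1 (enorm z `^ s)) ->
  mu.-integrable setT (EFin \o (fun z => phi z * ker alpha z)).
Proof.
move=> as_ mphi phiC.
apply: (@le_integrable _ _ _ _ _ _ _
  (fun z => (C%:E * (Num.min 1 (enorm z `^ s) * ker alpha z)%:E)%E)) => //.
- by apply/measurable_EFinP; apply: measurable_funM => //; exact: measurable_ker.
- move=> z _; rewrite -EFinM lee_fin /= mulrA !normrM (ger0_norm (ker_ge0 _ _)).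
  rewrite ler_wpM2r ?ker_ge0//; apply: le_trans (phiC z) _.
  by rewrite -normrM ler_norm.
- by apply: integrableZl => //; exact: integrable_min_ker.
Qed.

Lemma integrable_ker_away (alpha C eps : R) (phi : V -> R) A : 0 < alpha ->
  measurable_fun setT phi -> (forall z, `|phi z| <= C) ->
  0 < eps -> measurable A -> (forall z, A z -> eps <= enorm z) ->
  mu.-integrable A (EFin \o (fun z => phi z * ker alpha z)).
Proof.
move=> a0 mphi phiC e0 mA Ae.
have C0 : 0 <= C by apply: le_trans (phiC 0).
have a1 : 0 < alpha < alpha + 1 by rewrite a0 ltrDl/=.
apply/(integrable_mkcond _ mA).
rewrite (_ : _ \_ _ = EFin \o (fun z => (phi z * \1_A z) * ker alpha z)); last first.
  by apply/funext => z; rewrite /patch/= indicE; case: ifP; rewrite ?mulr1 ?mulr0 ?mul0r.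
pose m := Num.min 1 (eps `^ (alpha + 1)).
have m0 : 0 < m by rewrite lt_min ltr01 powR_gt0.
apply: (@integrable_mul_ker _ (alpha + 1) (C / m)) => //.
  by apply: measurable_funM => //; exact: measurable_indic.
move=> z; rewrite indicE; case: (boolP (z \in A)) => [|_]; last first.
  rewrite mulr0 normr0 mulr_ge0// ?divr_ge0// ?(ltW m0)//.
  by rewrite le_min ler01 powR_ge0.
rewrite inE mulr1 => /Ae ez; apply: le_trans (phiC z) _.
rewrite mulrAC ler_pdivlMr// ler_wpM2l// le_min ge_min lexx/=.
rewrite ge_min; apply/orP; right.
by rewrite ge0_ler_powR ?nnegrE ?enorm_ge0 ?addr_ge0// ltW.
Qed.

Lemma measurable_ker_sub alpha x : measurable_fun setT (fun y => ker alpha (x - y)).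
Proof.
rewrite (_ : (fun _ => _) = ker alpha \o (fun y => - x + y)).
  by apply: (measurableT_comp (measurable_ker _)); exact: (preserving_translate _).1.
by apply/funext => y /=; rewrite -kerN opprB addrC.
Qed.

Lemma measurable_enorm_sub x : measurable_fun setT (fun y : V => enorm (x - y)).
Proof.
rewrite (_ : (fun _ => _) = enorm \o (fun y => - x + y)).
  by apply: (measurableT_comp measurable_enorm); exact: (preserving_translate _).1.
by apply/funext => y /=; rewrite -enormN opprB addrC.
Qed.

Lemma measurable_away eps x : measurable [set y : V | eps <= enorm (x - y)].
Proof.
rewrite -[X in measurable X]setTI; apply: measurable_fun_le => //.
exact: measurable_enorm_sub.
Qed.

Lemma integrable_ker_sub_away alpha (C eps : R) (phi : V -> R) A x : 0 < alpha ->
  measurable_fun setT phi -> (forall z, `|phi z| <= C) ->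
  0 < eps -> measurable A -> (forall y, A y -> eps <= enorm (x - y)) ->
  mu.-integrable A (EFin \o (fun y => phi y * ker alpha (x - y))).
Proof.
move=> a0 mphi phiC e0 mA Ae.
have mx := (preserving_translate x); have mNx := (preserving_translate (- x)).
have mphix : measurable_fun setT (fun z : V => phi (x + z)).
  by apply: (measurableT_comp mphi); exact: mx.1.
pose B := (fun z => x + z) @^-1` A.
have mB : measurable B := measurable_preimage mx mA.
have iB : mu.-integrable B (EFin \o (fun z => phi (x + z) * ker alpha z)).
  apply: (@integrable_ker_away _ C eps) => // z /= Az.
  by have := Ae _ Az; rewrite opprD addrA subrr add0r enormN.
have mF : measurable_fun [set: V] (EFin \o (fun z => phi (x + z) * ker alpha z)).
  by apply/measurable_EFinP/measurable_funM => //; exact: measurable_ker.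
have := preserving_integrable mNx mB mF iB.
have -> : (fun y => - x + y) @^-1` B = A.
  by rewrite /B; apply/seteqP; split => y /=; rewrite addrA subrr add0r.
have -> // : (EFin \o (fun z => phi (x + z) * ker alpha z)) \o (fun y => - x + y) =
  EFin \o (fun y => phi y * ker alpha (x - y)).
by apply/funext => y /=; rewrite addrA subrr add0r -kerN opprD opprK.
Qed.

Lemma integrable_diff_ker alpha (a M eps : R) (u : V -> R) A x : 0 < alpha ->
  measurable_fun setT u -> (forall z, `|u z| <= M) -> `|a| <= M ->
  0 < eps -> measurable A -> (forall y, A y -> eps <= enorm (x - y)) ->
  mu.-integrable A (EFin \o (fun y => (a - u y) * ker alpha (x - y))).
Proof.
move=> a0 umeas uM aM e0 mA Ae.
have mB : measurable_fun [set: V] (fun y => a - u y).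
  exact: (measurable_funB (measurable_cst a) umeas).
have leB y : `|a - u y| <= M + M by apply: (le_trans (ler_normB _ _)); exact: lerD.
exact: (integrable_ker_sub_away a0 mB leB e0 mA Ae).
Qed.

(** Integrability has to be shown as well: an infinite integral would be read as 0, and so would its
    inverse. Positivity comes from a cube on which the integrand is bounded below. *)
Lemma frac_const_gt0 alpha : 0 < alpha < 2 -> 0 < frac_const (n := n) alpha.
Proof.
move=> a02; have /andP[a0 a2] := a02; rewrite /frac_const invr_gt0.
pose phi z : R := 1 - cos (z ord0 ord0 : R).
have mphi : measurable_fun setT phi.
  apply: measurable_funB => //.
  apply: (measurableT_comp (continuous_measurable_fun (@continuous_cos R))).
  exact: measurable_coord.
have phi0 z : 0 <= phi z by rewrite subr_ge0 cos_le1.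
have iphi : mu.-integrable setT (EFin \o (fun z => phi z * ker alpha z)).
  apply: (@integrable_mul_ker _ 2 2) => // z.
  rewrite ger0_norm// minr_pMr// le_min; apply/andP; split.
    by rewrite mulr1 /phi; have := cos_geN1 (z ord0 ord0 : R); lra.
  apply: le_trans (one_sub_cos_le _) _.
  rewrite powR_mulrn ?enorm_ge0// -[leLHS]real_normK ?num_real//.
  rewrite -[leLHS]mul1r ler_pM ?ler1n// ?sqr_ge0//.
  by rewrite ler_pXn2r ?nnegrE ?enorm_ge0// coord_le_enorm.
(* On [E] the first coordinate lies between pi/2 and pi/2 + 1 <= pi, so the cosine is at most 0
   there and 1 - cos is at least 1. *)
pose E := box (fun i => if i == ord0 then pi / 2 else 0) 1.
have mE : measurable E by exact: measurable_box.
pose K := n.+1%:R * (pi + 1 : R).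
have K0 : 0 < K by rewrite mulr_gt0// addr_gt0 ?pi_gt0.
pose c := (K `^ (n.+1%:R + alpha))^-1.
have c0 : 0 < c by rewrite invr_gt0 powR_gt0.
have cE z : E z -> c <= phi z * ker alpha z.
  move=> Ez; have := Ez ord0; rewrite eqxx => /andP[z1 z2].
  have pi2 := @pi_ge2 R; have pi0 := @pi_gt0 R.
  have cz : cos (z ord0 ord0 : R) <= 0.
    rewrite -(@cos_pihalf R) ltW// ltr_cos// in_itv/=; lra.
  have zK : enorm z <= K.
    apply: enorm_le_coord; first lra.
    move=> i; have := Ez i; case: ifP => _ /andP[]; rewrite ler_norml; lra.
  have z0 : 0 < enorm z.
    have := coord_le_enorm z ord0; apply: lt_le_trans.
    rewrite normr_gt0 gt_eqF//; lra.
  rewrite -[leLHS]mul1r ler_pM ?ler01 ?(ltW c0)//; first by rewrite /phi; lra.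
  rewrite lef_pV2 ?posrE ?powR_gt0//.
  by rewrite ge0_ler_powR ?nnegrE ?enorm_ge0 ?addr_ge0// ltW.
apply: (@lt_le_trans _ _ (\int[mu]_(z in E) c)).
  rewrite Rintegral_cst// lebesgue_box//= mulr_gt0// exprn_gt0//.
apply: (@le_trans _ _ (\int[mu]_(z in E) (phi z * ker alpha z))).
  apply: le_Rintegral => //.
    apply/integrableP; split; first exact/measurable_EFinP.
    rewrite /= integral_cst// lebesgue_box// -EFinM ltry//.
  by apply: integrableS iphi.
rewrite [leRHS](_ : _ = \int[mu]_z (phi z * ker alpha z))//.
rewrite Rintegral_mkcond; apply: le_Rintegral => //.
  have /(integrable_mkcond _ mE) : mu.-integrable E (EFin \o (fun z => phi z * ker alpha z)).
    exact: integrableS iphi.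
  by rewrite restrict_EFin.
by move=> z _; rewrite /patch; case: ifP => // _; rewrite mulr_ge0// ker_ge0.
Qed.

End kernel_integrals.

(** * Reflection *)

Section reflection.
Context {R : realType} {n : nat}.
Local Notation V := 'rV[R]_n.+1.
Local Notation mu := (lebesgue_rV n.+1).
Implicit Types (x y z : V) (alpha lambda : R) (A E : set V) (u w : V -> R).

Lemma reflect_coord0 lambda x :
  reflect_x1 lambda x ord0 ord0 = 2 * lambda - x ord0 ord0.
Proof. by rewrite mxE eqxx. Qed.

Lemma reflect_coord lambda x i : i != ord0 -> reflect_x1 lambda x ord0 i = x ord0 i.
Proof. by move=> i0; rewrite mxE (negbTE i0). Qed.

Lemma reflectK lambda : involutive (@reflect_x1 R n lambda).
Proof.
move=> x; apply/rowP => i; have [->|i0] := eqVneq i ord0.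
  by rewrite !reflect_coord0 opprB addrC subrK.
by rewrite !reflect_coord.
Qed.

Lemma enorm_reflect_sub lambda x y :
  enorm (reflect_x1 lambda x - reflect_x1 lambda y) = enorm (x - y).
Proof.
congr Num.sqrt; apply: eq_bigr => i _; have [->|i0] := eqVneq i ord0.
  by rewrite !mxE eqxx; ring.
by rewrite mxE [(- _ : 'rV_n.+1) _ _]mxE !reflect_coord// !mxE.
Qed.

Lemma enorm_sub_reflect lambda x y :
  enorm (x - reflect_x1 lambda y) = enorm (reflect_x1 lambda x - y).
Proof. by rewrite -(enorm_reflect_sub lambda) reflectK. Qed.

Lemma ker_reflect_sub alpha lambda x y :
  ker alpha (reflect_x1 lambda x - reflect_x1 lambda y) = ker alpha (x - y).
Proof. by rewrite /ker enorm_reflect_sub. Qed.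

(** Only the first coordinate changes, and the two squared distances differ by 4 (lambda -
    x_1)(lambda - y_1). *)
Lemma enorm_le_reflect lambda x y : x ord0 ord0 <= lambda -> y ord0 ord0 <= lambda ->
  enorm (x - y) <= enorm (x - reflect_x1 lambda y).
Proof.
move=> xl yl; rewrite /enorm ler_wsqrtr// ler_sum// => i _.
have [->|i0] := eqVneq i ord0; last by rewrite !mxE (negbTE i0).
rewrite !mxE eqxx -subr_ge0; set a := x _ _; set b := y _ _.
rewrite (_ : _ - _ = 4 * ((lambda - a) * (lambda - b))); last by ring.
by rewrite mulr_ge0// mulr_ge0// subr_ge0.
Qed.

Lemma measurable_reflect lambda : measurable_fun [set: V] (reflect_x1 lambda).
Proof. exact: (preserving_reflect n lambda).1. Qed.

Lemma reflect_diffN u lambda y :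
  reflect_diff u lambda (reflect_x1 lambda y) = - reflect_diff u lambda y.
Proof. by rewrite /reflect_diff reflectK opprB. Qed.

(** The joint contribution of y and its reflection: [a] and [b] are the values of an antisymmetric
    function at the minimum point x and at y, while [k] and [k'] are the kernel at y and at the
    reflected point. As a - b <= 0, lowering [k] to [k'] only increases the sum, which becomes 2 a
    k'. *)
Lemma pair_sum_le (a b k k' : R) : a <= 0 -> a <= b -> 0 <= k' <= k ->
  (a - b) * k + (a + b) * k' <= a * k'.
Proof.
move=> a0 ab /andP[k'0 k'k]; apply: (@le_trans _ _ ((a - b) * k' + (a + b) * k')).
  by rewrite lerD2r ler_wnM2l// subr_le0.
by rewrite -mulrDl ler_wpM2r//; lra.
Qed.

(* When A is the complement of the ball B_eps(x), the points of H_lambda outside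
   A whose reflection is in A are close to x, where w < 0 by continuity. *)
Lemma reflection_comparison alpha (M eps c lambda : R) w x A E :
  0 < alpha -> measurable_fun setT w -> (forall y, `|w y| <= M) ->
  (forall y, w (reflect_x1 lambda y) = - w y) ->
  x ord0 ord0 < lambda -> w x <= 0 ->
  (forall y, y ord0 ord0 < lambda -> w x <= w y) ->
  0 < eps -> measurable A -> (forall y, A y -> eps <= enorm (x - y)) ->
  (forall y, y ord0 ord0 < lambda -> A y -> A (reflect_x1 lambda y)) ->
  (forall y, y ord0 ord0 < lambda -> A (reflect_x1 lambda y) -> ~ A y -> w y <= 0) ->
  measurable E -> ((mu : {measure set V -> \bar R}) E < +oo)%E -> E `<=` A ->
  (forall y, E y -> lambda < y ord0 ord0 /\ c <= ker alpha (x - y)) -> 0 <= c ->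
  \int[mu]_(y in A) ((w x - w y) * ker alpha (x - y)) <=
    w x * c * fine ((mu : {measure set V -> \bar R}) E).
Proof.
move=> a0 mw wM wN xl wx0 wmin e0 mA Ae Arefl Anew mE muE EA Ec c0.
have mps := preserving_reflect n lambda.
have sK := @reflectK lambda.
have kk y : x ord0 ord0 <= lambda -> y ord0 ord0 <= lambda -> A y ->
    0 <= ker alpha (x - reflect_x1 lambda y) <= ker alpha (x - y).
  move=> xl' yl Ay; rewrite ker_ge0/=; apply: ker_le => //; first exact: lt_le_trans (Ae _ Ay).
  exact: enorm_le_reflect.
have s_gt y : lambda < y ord0 ord0 -> reflect_x1 lambda y ord0 ord0 < lambda.
  by rewrite reflect_coord0; lra.
have s_eq y : y ord0 ord0 = lambda -> reflect_x1 lambda y = y.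
  move=> yl; apply/rowP => i; have [->|i0] := eqVneq i ord0; last by rewrite reflect_coord.
  by rewrite reflect_coord0; lra.
(* From here on the reflection enters only through the facts just collected, and is kept abstract as
   [s]. *)
move: (@reflect_x1 R n lambda) wN Arefl Anew mps sK kk s_gt s_eq =>
  s wN Arefl Anew mps sK kk s_gt s_eq.
(* [g] is the integrand and [b] the lower-order target, both extended by zero; the aim is a
   pointwise inequality between their sums over the orbits of [s]. *)
pose g y := (w x - w y) * ker alpha (x - y) * \1_A y.
pose b y := w x * c * \1_E y.
have ig : mu.-integrable setT (EFin \o g).
  have /(integrable_mkcond _ mA) : mu.-integrable A (EFin \o (fun y => (w x - w y) * ker alpha (x - y))).
    exact: (integrable_diff_ker a0 mw wM (wM x) e0 mA Ae).
  congr (mu.-integrable setT _); apply/funext => y.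
  by rewrite /patch /= /g indicE; case: ifP; rewrite ?mulr1 ?mulr0.
have mg : measurable_fun [set: V] g by have /integrableP[/measurable_EFinP] := ig.
have mb : measurable_fun [set: V] b by apply: measurable_funM => //; exact: measurable_indic.
have i1 : mu.-integrable setT (EFin \o \1_E).
  apply/integrableP; split.
    by apply/measurable_EFinP; exact: measurable_indic.
  rewrite (_ : (fun _ => _) = (fun y => (\1_E y)%:E)); last first.
    by apply/funext => y /=; rewrite ger0_norm.
  by rewrite integral_indic// setIT.
have ib : mu.-integrable setT (EFin \o b).
  exact: (integrableZl measurableT (w x * c) i1).
have igs : mu.-integrable setT (EFin \o (g \o s)).
  have /measurable_EFinP mf := mg.
  by have := preserving_integrable mps measurableT mf ig; rewrite preimage_setT.
have ibs : mu.-integrable setT (EFin \o (b \o s)).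
  have /measurable_EFinP mf := mb.
  by have := preserving_integrable mps measurableT mf ib; rewrite preimage_setT.
have gA y : A y -> g y = (w x - w y) * ker alpha (x - y).
  by move=> Ay; rewrite /g indicE mem_set// mulr1.
have gN y : ~ A y -> g y = 0.
  by move=> nAy; rewrite /g indicE memNset// mulr0.
(* If y and [s y] are both in [A], this is the pairing inequality. If only [s y] is, then [w y <= 0]
   gives it directly. If neither is, both sides vanish because [E] lies in [A]. *)
have gb_lt y : y ord0 ord0 < lambda -> g y + g (s y) <= b y + b (s y).
  move=> yl; have nEy : ~ E y by move=> /Ec[/lt_trans/(_ yl)]; rewrite ltxx.
  rewrite {1}/b indicE memNset// mulr0 add0r.
  have bs : A (s y) -> w x * ker alpha (x - s y) <= b (s y).
    move=> _; rewrite /b -mulrA ler_wnM2l// indicE; case: (boolP (_ \in _)) => [|_].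
      by rewrite inE mulr1 => /Ec[].
    by rewrite mulr0 ker_ge0.
  have k0 := ker_ge0 alpha (x - s y).
  have [Ay|nAy] := pselect (A y).
    have Asy := Arefl _ yl Ay; apply: le_trans (bs Asy).
    rewrite (gA _ Ay) (gA _ Asy) wN opprK.
    by apply: pair_sum_le => //; [exact: wmin|apply: kk => //; exact: ltW].
  rewrite (gN _ nAy) add0r.
  have [Asy|nAsy] := pselect (A (s y)); last first.
    by rewrite (gN _ nAsy) /b indicE memNset ?mulr0// => /EA.
  apply: le_trans (bs Asy); rewrite (gA _ Asy) wN opprK ler_wpM2r//.
  by rewrite gerDl; exact: Anew.
(* Beyond the hyperplane the claim is the previous one with y and [s y] exchanged; on the hyperplane
   antisymmetry forces [w y = 0]. *)
have gb y : g y + g (s y) <= b y + b (s y).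
  have [yl|yl|yl] := ltgtP (y ord0 ord0) lambda; first exact: gb_lt.
    by have := gb_lt _ (s_gt _ yl); rewrite sK addrC [leRHS]addrC.
  have wy : w y = 0.
    by apply/eqP; rewrite -(eqNr (w y)) -wN s_eq.
  have by0 : b y = 0.
    by rewrite /b indicE memNset ?mulr0// => /Ec[]; rewrite yl ltxx.
  suff gy0 : g y <= 0 by rewrite s_eq// by0 addr0 -[leRHS]addr0 lerD.
  by rewrite /g wy subr0 mulr_le0_ge0// mulr_le0_ge0// ker_ge0.
have intg : \int[mu]_y g (s y) = \int[mu]_y g y.
  by have := preserving_Rintegral mps measurableT mg ig; rewrite preimage_setT.
have intb : \int[mu]_y b (s y) = \int[mu]_y b y.
  by have := preserving_Rintegral mps measurableT mb ib; rewrite preimage_setT.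
(* As [s] preserves the measure, each side is twice the integral of [g], respectively of [b]. *)
have : \int[mu]_y (g y + g (s y)) <= \int[mu]_y (b y + b (s y)).
  apply: le_Rintegral => //.
    exact: (integrableD measurableT ig igs).
  exact: (integrableD measurableT ib ibs).
rewrite !RintegralD// intg intb => gb2.
have gb3 : \int[mu]_y g y <= \int[mu]_y b y by lra.
rewrite Rintegral_mkcond; apply: (@le_trans _ _ (\int[mu]_y g y)).
  rewrite le_eqVlt; apply/orP; left; apply/eqP; apply: eq_Rintegral => y _.
  by rewrite /patch /= /g indicE; case: ifP; rewrite ?mulr1 ?mulr0.
apply: (le_trans gb3); rewrite /b RintegralZl//.
rewrite le_eqVlt; apply/orP; left; apply/eqP; congr (_ * _).
by rewrite /Rintegral integral_indic// setIT.
Qed.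

(** The substitution of the reflected variable turns the terms of u composed with the reflection
    into an integral centred at the reflected point, the kernel being invariant under isometries. *)
Lemma reflect_diff_integral alpha (M eps lambda : R) u x A :
  0 < alpha -> measurable_fun setT u -> (forall y, `|u y| <= M) ->
  0 < eps -> measurable A -> (forall y, A y -> eps <= enorm (x - y)) ->
  \int[mu]_(y in A) ((reflect_diff u lambda x - reflect_diff u lambda y) * ker alpha (x - y)) =
  \int[mu]_(y in reflect_x1 lambda @^-1` A)
     ((u (reflect_x1 lambda x) - u y) * ker alpha (reflect_x1 lambda x - y)) -
  \int[mu]_(y in A) ((u x - u y) * ker alpha (x - y)).
Proof.
move=> a0 umeas uM e0 mA Ae; rewrite /reflect_diff.
have mps := preserving_reflect n lambda.
have sK := @reflectK lambda.
have ks y : ker alpha (reflect_x1 lambda x - y) = ker alpha (x - reflect_x1 lambda y).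
  by rewrite -[LHS](ker_reflect_sub alpha lambda) reflectK.
move: (@reflect_x1 R n lambda) mps sK ks => s mps sK ks.
have msA : measurable (s @^-1` A) by exact: (measurable_preimage mps mA).
have mus : measurable_fun setT (fun y => u (s y)) by exact: (measurableT_comp umeas mps.1).
have ints z : mu.-integrable A (EFin \o (fun y => (u (s z) - u (s y)) * ker alpha (x - y))).
  exact: (integrable_diff_ker a0 mus (fun y => uM (s y)) (uM (s z)) e0 mA Ae).
have mF : measurable_fun [set: V] (fun y => (u (s x) - u (s y)) * ker alpha (x - y)).
  apply: measurable_funM; last exact: measurable_ker_sub.
  exact: (measurable_funB (measurable_cst _) mus).
have E := preserving_Rintegral mps mA mF (ints x).
have -> : \int[mu]_(y in s @^-1` A) ((u (s x) - u y) * ker alpha (s x - y)) =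
    \int[mu]_(y in A) ((u (s x) - u (s y)) * ker alpha (x - y)).
  by rewrite -E; apply: eq_Rintegral => y _; rewrite ks sK.
have iu : mu.-integrable A (EFin \o (fun y => (u x - u y) * ker alpha (x - y))).
  exact: (integrable_diff_ker a0 umeas uM (uM x) e0 mA Ae).
rewrite -(RintegralB mA (ints x) iu); apply: eq_Rintegral => y _.
have H (a b c d k : R) : (a - b - (c - d)) * k = (a - c) * k - (b - d) * k by ring.
exact: H.
Qed.

End reflection.

(** * Second differences and continuity of the fractional Laplacian *)

Lemma Rintegral_dominated_cvg d (T : measurableType d) (R : realType)
    (mu : {measure set T -> \bar R}) (f_ : nat -> T -> R) (f g : T -> R) :
  (forall k, measurable_fun [set: T] (f_ k)) -> measurable_fun [set: T] f ->
  (forall z, f_ k z @[k --> \oo] --> f z) ->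
  mu.-integrable setT (EFin \o g) -> (forall k z, `|f_ k z| <= g z) ->
  \int[mu]_z f_ k z @[k --> \oo] --> \int[mu]_z f z.
Proof.
move=> mf_ mf f_f ig f_g.
have mf_E k : measurable_fun [set: T] (EFin \o f_ k) by exact/measurable_EFinP.
have mfE : measurable_fun [set: T] (EFin \o f) by exact/measurable_EFinP.
have aecvg : {ae mu, forall z, setT z -> (EFin \o f_ k) z @[k --> \oo] --> (EFin \o f) z}.
  by apply: aeW => z _; apply: cvg_EFin; [exact: nearW|exact: f_f].
have aebnd : {ae mu, forall z k, setT z -> (`|(EFin \o f_ k) z| <= (EFin \o g) z)%E}.
  by apply: aeW => z k _; rewrite /= lee_fin.
have [intf _ cv] := dominated_convergence measurableT mf_E mfE aecvg ig aebnd.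
apply: fine_cvg; rewrite fineK; first exact: cv.
exact: integrable_fin_num.
Qed.

Section second_differences.
Context {R : realType} {n : nat}.
Local Notation V := 'rV[R]_n.+1.
Local Notation mu := (lebesgue_rV n.+1).
Implicit Types (x y z : V) (alpha theta : R) (u : V -> R).

Lemma compact_norm_ball x (r : R) : compact [set y : V | `|y - x| <= r].
Proof.
apply: bounded_closed_compact.
  exists (r + `|x|); split; first exact: num_real.
  move=> M rM y /= yr; apply: le_trans (ltW rM).
  by rewrite -[y](subrK x) (le_trans (ler_normD _ _))// lerD2r.
rewrite (_ : [set y | _] = (fun y => `|y - x|) @^-1` [set t | t <= r])//.
apply: closed_comp; last exact: closed_le.
move=> y _; apply: continuous_comp; last exact: norm_continuous.
by apply: continuousB => //; exact: cst_continuous.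
Qed.

Lemma vanishing_bounded u : continuous u -> vanishes_at_infty u ->
  exists M, forall x, `|u x| <= M.
Proof.
move=> cu /(_ 1 ltr01)[M0 hM0].
(* [M0] may be negative; the maximum with 0 keeps the ball nonempty. *)
pose K := [set y : V | `|y - 0| <= Num.max M0 0].
have cK : compact K by exact: compact_norm_ball.
have K0 : K !=set0 by exists 0; rewrite /K /= subrr normr0 le_max lexx orbT.
have cuK : {within K, continuous (fun y => `|u y|)}.
  apply: continuous_subspaceT => y.
  by apply: continuous_comp; [exact: cu|exact: norm_continuous].
have [c _ hc] := compact_EVT_max K0 cK cuK.
exists (Num.max 1 `|u c|) => x; rewrite le_max.
have [xM|xM] := ltP M0 (enorm x); first by rewrite ltW ?hM0.
apply/orP; right; apply: hc; rewrite inE /K /= subr0 le_max.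
by rewrite (le_trans (norm_le_enorm x)).
Qed.

Lemma is_derive_line u x z (t : R) : (forall y, differentiable u y) ->
  is_derive t (1 : R) (fun t : R => u (x + t *: z)) ('D_z u (x + t *: z)).
Proof.
move=> du; have dz : derivable u (x + t *: z) z by exact: diff_derivable.
have E : (fun h : R => h^-1 *: (u (x + (h *: (1 : R) + t) *: z) - u (x + t *: z))) =
         (fun h : R => h^-1 *: (u (h *: z + (x + t *: z)) - u (x + t *: z))).
  apply/funext => h; congr (_ *: (u _ - _)).
  by rewrite scalerDl [_ *: 1]mulr1 addrCA.
by split; [rewrite /derivable E|rewrite /derive E].
Qed.

Lemma derive_sum_partials u y z : differentiable u y ->
  'D_z u y = \sum_i z ord0 i * 'D_(delta_mx ord0 i) u y.
Proof.
move=> du; rewrite deriveE// {1}(row_sum_delta z) linear_sum.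
by apply: eq_bigr => i _; rewrite linearZ /= deriveE.
Qed.

(** The average of u x - u (x + z) and u x - u (x - z), that is, minus half the symmetric second
    difference. *)
Definition sdiff u x z : R := (2 * u x - u (x + z) - u (x - z)) / 2.

(** By the mean value theorem on [0,1] for u (x + t z) + u (x - t z), the second difference is a
    difference of derivatives along z at two points at distance at most 2|z|. The Hölder bound on
    the partial derivatives then gives the order 1 + theta. *)
Lemma sdiff_holder theta u x0 : 0 < theta -> C1_holder_loc theta u ->
  exists C, forall x z, enorm (x - x0) <= 1 -> enorm z <= 1 ->
    `|sdiff u x z| <= C * enorm z `^ (1 + theta).
Proof.
move=> th0 [du hol].
(* Radius 2: x is within 1 of [x0], and the increments have length at most 1. *)
pose K := [set y : V | `|y - x0| <= 2].
have [M hM] := choice (fun i => hol i K (@compact_norm_ball x0 2)).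
pose S := \sum_i `|M i|.
have S0 : 0 <= S by exact: sumr_ge0.
exists (2^-1 * S * 2 `^ theta) => x z xx0 z1.
pose phi (t : R) := u (x + t *: z) + u (x + t *: (- z)).
pose dphi (t : R) := 'D_z u (x + t *: z) + 'D_(- z) u (x + t *: (- z)).
have phid t : is_derive t (1 : R) phi (dphi t).
  by apply: is_deriveD; exact: is_derive_line.
have [|t t01] := @MVT_segment R phi dphi 0 1 ler01 (fun t _ => phid t).
  apply: derivable_within_continuous => t _; exact: (@ex_derive _ _ _ _ _ _ _ (phid t)).
rewrite subr0 mulr1 /phi !scale1r !scale0r !addr0 => phi1.
have [a aE] : exists a, a = x + t *: z by exists (x + t *: z).
have [b bE] : exists b, b = x + t *: (- z) by exists (x + t *: (- z)).
have tz : enorm (t *: z) <= enorm z.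
  move: t01; rewrite in_itv/= enormZ => /andP[t0 t1].
  by rewrite ger0_norm// -[leRHS]mul1r ler_wpM2r// enorm_ge0.
have Kxy y : enorm y <= enorm z -> K (x + y).
  move=> yz; rewrite /K /= addrAC (le_trans (ler_normD _ _))// [leRHS](_ : _ = 1 + 1)// lerD//.
    exact: le_trans (norm_le_enorm _) xx0.
  exact: le_trans (norm_le_enorm _) (le_trans yz z1).
have Ka : K a by rewrite aE; exact: Kxy.
have Kb : K b by rewrite bE; apply: Kxy; rewrite scalerN enormN.
have ab : enorm (a - b) <= 2 * enorm z.
  have -> : a - b = (2 : R) *: (t *: z).
    by rewrite aE bE scalerN opprD addrACA subrr add0r opprK scaler_nat mulr2n.
  by rewrite enormZ ger0_norm// ler_wpM2l.
have dphiE : dphi t = \sum_i z ord0 i *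
    ('D_(delta_mx ord0 i) u a - 'D_(delta_mx ord0 i) u b).
  rewrite /dphi -aE -bE !derive_sum_partials// -big_split/=.
  by apply: eq_bigr => i _; rewrite mxE mulNr mulrBr.
have dphi_le : `|dphi t| <= enorm z * (S * (2 * enorm z) `^ theta).
  rewrite dphiE (le_trans (ler_norm_sum _ _ _))//.
  rewrite mulr_suml mulr_sumr ler_sum// => i _; rewrite normrM.
  rewrite ler_pM// ?coord_le_enorm//.
  apply: le_trans (hM i a b Ka Kb) _.
  apply: (@le_trans _ _ (`|M i| * enorm (a - b) `^ theta)).
    by rewrite ler_wpM2r ?powR_ge0// ler_norm.
  rewrite ler_wpM2l// ge0_ler_powR ?nnegrE ?enorm_ge0 ?mulr_ge0 ?enorm_ge0//.
  exact: ltW.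
have -> : sdiff u x z = - (2^-1 * dphi t).
  have sE (p q r : R) : (2 * p - q - r) / 2 = - (2^-1 * (q + r - (p + p))) by field.
  by rewrite -phi1 /sdiff sE.
rewrite normrN normrM ger0_norm ?invr_ge0// -!mulrA ler_wpM2l ?invr_ge0//.
apply: le_trans dphi_le _; rewrite powRM ?enorm_ge0//.
rewrite powRD; last by rewrite gt_eqF// addr_gt0.
rewrite powRr1 ?enorm_ge0// le_eqVlt; apply/orP; left; apply/eqP.
rewrite mulrCA; congr (_ * _).
exact: mulrCA.
Qed.

Lemma measurable_sdiff u x : measurable_fun setT u ->
  measurable_fun [set: V] (sdiff u x).
Proof.
move=> umeas; apply: measurable_funM; last exact: measurable_cst.
apply: measurable_funB.
  apply: measurable_funB; first exact: measurable_cst.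
  exact: (measurableT_comp umeas (preserving_translate x).1).
apply: (measurableT_comp umeas).
exact: (measurableT_comp (preserving_translate x).1 (preserving_opp _).1).
Qed.

(** The Hölder bound serves for |z| <= 1 and the sup bound 2M beyond. The constant is uniform for x
    near [x0], as dominated convergence in x requires. *)
Lemma sdiff_le_min theta (M : R) u x0 : 0 < theta -> C1_holder_loc theta u ->
  (forall y, `|u y| <= M) ->
  exists C, forall x z, enorm (x - x0) <= 1 ->
    `|sdiff u x z| <= C * Num.min 1 (enorm z `^ (1 + theta)).
Proof.
move=> th0 hu uM; have [C hC] := sdiff_holder x0 th0 hu.
have M0 : 0 <= M by exact: le_trans (uM 0).
exists (Num.max C (2 * M)) => x z xx0.
have [z1|z1] := leP (enorm z) 1.
  apply: le_trans (hC _ _ xx0 z1) _; rewrite min_r; last first.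
    have := @ge0_ler_powR R (1 + theta) _ (enorm z) 1; rewrite powR1; apply.
    - by rewrite addr_ge0// ltW.
    - by rewrite nnegrE enorm_ge0.
    - by rewrite nnegrE.
    - exact: z1.
  by rewrite ler_wpM2r ?powR_ge0// le_max lexx.
rewrite min_l; last first.
  have := @ge0_ler_powR R (1 + theta) _ 1 (enorm z); rewrite powR1; apply.
  - by rewrite addr_ge0// ltW.
  - by rewrite nnegrE.
  - by rewrite nnegrE enorm_ge0.
  - exact: ltW.
rewrite mulr1 le_max; apply/orP; right.
rewrite /sdiff normrM [X in _ * X]ger0_norm ?invr_ge0// ler_pdivrMr//.
apply: le_trans (ler_normB _ _) _.
have h1 := ler_normB (2 * u x) (u (x + z)).
have h2 : `|2 * u x| = 2 * `|u x| by rewrite normrM ger0_norm.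
have := uM x; have := uM (x + z); have := uM (x - z).
by move: h1; rewrite h2; move: `|_ - _| `|u x| `|u _| `|u _| => p q r t; lra.
Qed.

End second_differences.

Lemma preserving_comp d (T : measurableType d) (R : realType)
    (mu : {measure set T -> \bar R}) (f g : T -> T) :
  measure_preserving mu f -> measure_preserving mu g ->
  measure_preserving mu (f \o g).
Proof.
move=> mpf [mg pg]; have [mf pf] := mpf; split; first exact: measurableT_comp.
by move=> A mA; rewrite comp_preimage pg ?pf//; exact: measurable_preimage mpf mA.
Qed.

(** * The fractional Laplacian as an absolutely convergent integral *)

Section fractional_laplacian.
Context {R : realType} {n : nat}.
Local Notation V := 'rV[R]_n.+1.
Local Notation mu := (lebesgue_rV n.+1).
Variables (alpha theta M : R) (u : V -> R).
Hypotheses (alpha_gt0 : 0 < alpha) (theta_gt : Num.max 0 (alpha - 1) < theta).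
Hypotheses (umeas : measurable_fun setT u) (uC : C1_holder_loc theta u).
Hypothesis (uM : forall y, `|u y| <= M).

Let theta_gt0 : 0 < theta.
Proof. by move: theta_gt; rewrite gt_max => /andP[]. Qed.

(** The exponent condition under which the second-difference bound is integrable against the kernel
    at the origin. *)
Let alpha_lt : 0 < alpha < 1 + theta.
Proof. by move: theta_gt; rewrite gt_max alpha_gt0 ltrBlDl => /andP[]. Qed.

Definition frac_integral (x : V) : R := \int[mu]_z (sdiff u x z * ker alpha z).

Let measurable_integrand x : measurable_fun [set: V] (fun z => sdiff u x z * ker alpha z).
Proof. by apply: measurable_funM; [exact: measurable_sdiff|exact: measurable_ker]. Qed.

(** One majorant for all x in the unit ball around [x0]; it serves both for removing the truncation
    and for continuity in x. *)
Let dominating x0 : exists g : V -> R,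
  mu.-integrable setT (EFin \o g) /\
  forall x z, enorm (x - x0) <= 1 -> `|sdiff u x z * ker alpha z| <= g z.
Proof.
have [C hC] := sdiff_le_min x0 theta_gt0 uC uM.
exists (fun z => C * (Num.min 1 (enorm z `^ (1 + theta)) * ker alpha z)); split.
  exact: (integrableZl measurableT C (integrable_min_ker alpha_lt)).
move=> x z xx0; rewrite normrM (ger0_norm (ker_ge0 _ _)) mulrA ler_wpM2r ?ker_ge0//.
exact: hC.
Qed.

(** The excised ball is symmetric about x, so the substitutions y = x + z and y = x - z give the
    same value; the right-hand side is their average. *)
Lemma truncated_integralE (eps : R) x : 0 < eps ->
  \int[mu]_(y in [set y | eps <= enorm (x - y)]) ((u x - u y) * ker alpha (x - y)) =
  \int[mu]_z (sdiff u x z * ker alpha z * \1_[set z | eps <= enorm z] z).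
Proof.
move=> e0; set D := [set y | _]; set B := [set z : V | _].
have [F FE] : exists F : V -> R, F = (fun y => (u x - u y) * ker alpha (x - y)).
  by eexists.
rewrite -FE.
have mD : measurable D := measurable_away eps x.
have iF : mu.-integrable D (EFin \o F).
  by rewrite FE; apply: (integrable_diff_ker alpha_gt0 umeas uM (uM x) e0 mD) => y.
have mF : measurable_fun [set: V] F.
  rewrite FE; apply: measurable_funM; last exact: measurable_ker_sub.
  exact: (measurable_funB (measurable_cst _) umeas).
have mp1 := preserving_translate x.
have mp2 := preserving_comp mp1 (preserving_opp n.+1).
have E1 := preserving_Rintegral mp1 mD mF iF.
have E2 := preserving_Rintegral mp2 mD mF iF.
have mFE : measurable_fun [set: V] (EFin \o F) by exact/measurable_EFinP.
have i1 := preserving_integrable mp1 mD mFE iF.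
have i2 := preserving_integrable mp2 mD mFE iF.
have B1 : (fun z => x + z) @^-1` D = B.
  by apply/seteqP; split => z /=; rewrite /D /B /= opprD addrA subrr add0r enormN.
have B2 : ((fun z => x + z) \o -%R) @^-1` D = B.
  by apply/seteqP; split => z /=; rewrite /D /B /= opprD addrA subrr add0r opprK.
rewrite B1 in E1 i1; rewrite B2 in E2 i2.
have mB : measurable B by rewrite -B1; exact: measurable_preimage mp1 mD.
have E3 := RintegralD mB i1 i2.
have E4 : \int[mu]_(z in B) (F (x + z) + F (x - z)) = 2 * \int[mu]_(y in D) F y.
  transitivity (\int[mu]_(y in D) F y + \int[mu]_(y in D) F y); last first.
    by rewrite mulr_natl mulr2n.
  by rewrite -{1}E1 -E2; exact: E3.
transitivity (2^-1 * \int[mu]_(z in B) (F (x + z) + F (x - z))).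
  by rewrite E4 mulKf.
have i3 : mu.-integrable B (EFin \o (fun z => F (x + z) + F (x - z))).
  exact: (integrableD mB i1 i2).
rewrite -(RintegralZl 2^-1 mB i3) Rintegral_mkcond; apply: eq_Rintegral => z _.
rewrite /patch indicE; case: ifP => _; last by rewrite mulr0.
rewrite mulr1 FE /sdiff !opprD !addrA subrr !add0r opprK kerN.
have H (p q r k : R) : 2^-1 * ((p - q) * k + (p - r) * k) = (2 * p - q - r) / 2 * k by field.
exact: H.
Qed.

Lemma truncated_integral_cvg x :
  (fun eps : R => \int[mu]_(y in [set y | eps <= enorm (x - y)])
     ((u x - u y) * ker alpha (x - y))) @ 0^'+ --> frac_integral x.
Proof.
apply/cvg_at_rightP => e [e0 ecvg].
rewrite (_ : (fun k => _) = fun k : nat =>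
    \int[mu]_z (sdiff u x z * ker alpha z * \1_[set z | e k <= enorm z] z)); last first.
  by apply/funext => k; rewrite truncated_integralE.
have [g [ig hg]] := dominating x.
have xx1 : enorm (x - x) <= 1 by rewrite subrr enorm0.
apply: (Rintegral_dominated_cvg _ _ _ ig).
- move=> k; apply: measurable_funM; first exact: measurable_integrand.
  apply: measurable_indic; rewrite -[X in measurable X]setTI.
  by apply: measurable_fun_le => //; exact: measurable_enorm.
- exact: measurable_integrand.
(* At the origin the indicator stays 0, but so does the kernel by convention; elsewhere the
   indicator is eventually 1. *)
- move=> z; have [z0|z0] := eqVneq (enorm z) 0.
    have -> : ker alpha z = 0 by rewrite /ker z0 powR0 ?invr0// gt_eqF// addr_gt0.
    rewrite mulr0; under eq_fun do rewrite mul0r; exact: cvg_cst.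
  have zp : 0 < enorm z by rewrite lt_neqAle eq_sym z0 enorm_ge0.
  apply: cvg_near_cst; move/cvgrPdist_lt : ecvg => /(_ _ zp).
  apply: filterS => k; rewrite sub0r normrN gtr0_norm// => ek.
  by rewrite indicE mem_set ?mulr1//=; exact: ltW.
- move=> k z; apply: le_trans (hg x z xx1); rewrite normrM ler_piMr// indicE.
  by case: (_ \in _); rewrite ?normr1 ?normr0.
Qed.

Lemma frac_laplacianE x :
  frac_laplacian alpha u x = frac_const (n := n) alpha * frac_integral x.
Proof.
by rewrite /frac_laplacian; congr (_ * _); apply: cvg_lim => //; exact: truncated_integral_cvg.
Qed.

Lemma frac_laplacian_cvg_seq (x_ : nat -> V) x :
  (forall k, enorm (x_ k - x) <= 1) -> x_ k @[k --> \oo] --> x ->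
  frac_laplacian alpha u (x_ k) @[k --> \oo] --> frac_laplacian alpha u x.
Proof.
move=> x1 xcvg; rewrite frac_laplacianE.
under eq_fun do rewrite frac_laplacianE.
apply: cvgMr; have [g [ig hg]] := dominating x.
have cu y : {for y, continuous u} by exact/differentiable_continuous/(uC.1 y).
apply: (Rintegral_dominated_cvg _ _ _ ig).
- by move=> k; exact: measurable_integrand.
- exact: measurable_integrand.
- move=> z; apply: cvgMl; apply: cvgMl.
  have cuz (a : V) : u (x_ k + a) @[k --> \oo] --> u (x + a).
    apply: (@cvg_comp _ _ _ (fun k => x_ k + a) u _ (nbhs (x + a))); last exact: cu.
    by apply: cvgD => //; exact: cvg_cst.
  apply: cvgB; last exact: cuz.
  apply: cvgB; last exact: cuz.
  apply: cvgMr; have := cuz 0; rewrite addr0; under eq_fun do rewrite addr0.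
  exact.
- by move=> k z; apply: hg; exact: x1.
Qed.

End fractional_laplacian.

(** * Calculus on the quadrant *)

Section quadrant_calculus.
Context {R : realType}.
Implicit Types (f : R -> R -> R) (F : R * R -> R).

Lemma within_quadrant_dist F (a b e : R) :
  {within quadrant, continuous F} -> 0 <= a -> 0 <= b -> 0 < e ->
  exists2 d : R, 0 < d & forall a' b' : R, 0 <= a' -> 0 <= b' ->
    `|a' - a| < d -> `|b' - b| < d -> `|F (a', b') - F (a, b)| < e.
Proof.
move=> /(subspace_continuousP quadrant F)/(_ (a, b)) h a0 b0 e0.
have /cvgrPdist_lt/(_ _ e0) := h (conj a0 b0).
rewrite near_withinE => /nbhs_ballP[d d0 hd]; exists d => // a' b' a'0 b'0 ad bd.
rewrite distrC; apply: (hd (a', b')); last by split.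
by split; rewrite /ball /= distrC.
Qed.

Lemma within_quadrant_cvg F (a_ b_ : nat -> R) (a b : R) :
  {within quadrant, continuous F} ->
  (forall k, 0 <= a_ k) -> (forall k, 0 <= b_ k) -> 0 <= a -> 0 <= b ->
  a_ k @[k --> \oo] --> a -> b_ k @[k --> \oo] --> b ->
  F (a_ k, b_ k) @[k --> \oo] --> F (a, b).
Proof.
move=> cF a_0 b_0 a0 b0 ca cb; apply/cvgrPdist_lt => e e0.
have [d d0 hd] := within_quadrant_dist cF a0 b0 e0.
near=> k; rewrite distrC; apply: hd => //; rewrite distrC; near: k.
  by move/cvgrPdist_lt : ca; exact.
by move/cvgrPdist_lt : cb; exact.
Unshelve. all: by end_near. Qed.

(** Used to obtain the claim on v from the claim on u by exchanging the two unknowns. *)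
Lemma C1_quadrant_swap f : C1_quadrant f -> C1_quadrant (fun a b => f b a).
Proof.
have swap F : {within quadrant, continuous F} ->
    {within quadrant, continuous (fun p : R * R => F (p.2, p.1))}.
  move=> cF; apply/subspace_continuousP => -[a b] [a0 b0].
  apply/cvgrPdist_lt => e e0; rewrite near_withinE.
  have [d d0 hd] := within_quadrant_dist cF b0 a0 e0.
  apply/nbhs_ballP; exists d => // -[a' b'] [/= aa bb] [/= a'0 b'0].
  by rewrite distrC; apply: hd => //; rewrite distrC.
move=> [cf [f1 [f2 [c1 c2 fd]]]]; split; first exact: (swap _ cf).
exists (fun p => f2 (p.2, p.1)), (fun p => f1 (p.2, p.1)).
split; [exact: swap|exact: swap|move=> a b a0 b0].
by have [] := fd _ _ b0 a0.
Qed.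

(** On the open quadrant the partial derivatives coincide with their continuous extensions. The
    bound [K] comes from compactness of the closed square, hence holds up to the axes; this matters
    because u and v tend to 0 at infinity. *)
Lemma C1_quadrant_partials f : C1_quadrant f ->
  [/\ {within quadrant, continuous (fun p : R * R => f p.1 p.2)},
    forall (a b e : R), 0 < a -> 0 < b -> 0 < e -> exists2 d : R, 0 < d &
      forall a' b' : R, 0 < a' -> 0 < b' -> `|a' - a| < d -> `|b' - b| < d ->
      `|partial1 f a' b' - partial1 f a b| < e /\
      `|partial2 f a' b' - partial2 f a b| < e,
    (forall a b : R, 0 < a -> 0 < b ->
      is_derive a (1 : R) (fun s => f s b) (partial1 f a b) /\
      is_derive b (1 : R) (f a) (partial2 f a b)) &
    forall M : R, 0 <= M -> exists2 K : R, 0 < K &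
      forall a b : R, 0 < a <= M -> 0 < b <= M ->
      `|partial1 f a b| <= K /\ `|partial2 f a b| <= K].
Proof.
move=> [cf [f1 [f2 [c1 c2 fd]]]].
have E1 (a b : R) : 0 < a -> 0 < b -> partial1 f a b = f1 (a, b).
  move=> a0 b0; have [d1 _] := fd _ _ a0 b0.
  by rewrite /partial1 derive1E; exact: derive_val.
have E2 (a b : R) : 0 < a -> 0 < b -> partial2 f a b = f2 (a, b).
  move=> a0 b0; have [_ d2] := fd _ _ a0 b0.
  by rewrite /partial2 derive1E; exact: derive_val.
split => //.
- move=> a b e a0 b0 e0.
  have [d1 d10 h1] := within_quadrant_dist c1 (ltW a0) (ltW b0) e0.
  have [d2 d20 h2] := within_quadrant_dist c2 (ltW a0) (ltW b0) e0.
  exists (Num.min d1 d2); first by rewrite lt_min d10.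
  move=> a' b' a'0 b'0; rewrite !lt_min => /andP[a1 a2] /andP[b1 b2].
  by rewrite !E1// !E2//; split; [apply: h1|apply: h2] => //; exact: ltW.
- by move=> a b a0 b0; rewrite E1// E2//; exact: fd.
- move=> M M0; pose S := `[0, M]%classic `*` `[0, M]%classic : set (R * R).
  have cS : compact S by apply: compact_setX; exact: segment_compact.
  have S0 : S !=set0 by exists (0, 0); split; rewrite /= in_itv/= lexx M0.
  have SQ : S `<=` quadrant.
    by move=> p [/=]; rewrite !in_itv/= => /andP[p1 _] /andP[p2 _].
  have bnd F : {within quadrant, continuous F} ->
      exists K, forall p, S p -> `|F p| <= K.
    move=> cF; have cSF := continuous_subspaceW SQ cF.
    have cN : {within S, continuous (fun p => `|F p|)}.
      by move=> p; apply: continuous_comp; [exact: cSF|exact: norm_continuous].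
    have [c _ hc] := compact_EVT_max S0 cS cN.
    by exists `|F c| => p Sp; apply: hc; rewrite inE.
  have [K1 hK1] := bnd _ c1; have [K2 hK2] := bnd _ c2.
  exists (Num.max 1 (Num.max K1 K2)); first by rewrite lt_max ltr01.
  move=> a b /andP[a0 aM] /andP[b0 bM]; rewrite E1// E2// !le_max.
  have Sab : S (a, b) by split; rewrite /= in_itv/= ?(ltW a0) ?(ltW b0).
  by rewrite hK1// hK2// !orbT.
Qed.

Lemma MVT_between (phi dphi : R -> R) (a a' : R) : 0 < a -> 0 < a' ->
  (forall x : R, 0 < x -> is_derive x (1 : R) phi (dphi x)) ->
  exists c, [/\ 0 < c, `|c - a| <= `|a' - a| &
    phi a' - phi a = dphi c * (a' - a)].
Proof.
have main (p q : R) : 0 < p -> p <= q ->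
    (forall x : R, 0 < x -> is_derive x (1 : R) phi (dphi x)) ->
    exists2 c, p <= c <= q & phi q - phi p = dphi c * (q - p).
  move=> p0 pq hphi.
  have dphi' x : x \in `]p, q[ -> is_derive x (1 : R) phi (dphi x).
    by rewrite in_itv/= => /andP[px _]; apply: hphi; exact: lt_trans px.
  have [|c] := @MVT_segment R phi dphi p q pq dphi'.
    apply: derivable_within_continuous => x; rewrite in_itv/= => /andP[px _].
    exact: (@ex_derive _ _ _ _ _ _ _ (hphi x (lt_le_trans p0 px))).
  by rewrite in_itv/=; exists c.
move=> a0 a'0 hphi; have [aa|aa] := leP a a'.
  have [c /andP[ac ca'] ->] := main _ _ a0 aa hphi.
  exists c; split => //; first exact: lt_le_trans ac.
  by rewrite !ger0_norm ?subr_ge0// lerD2r.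
have [c /andP[ac ca'] h] := main _ _ a'0 (ltW aa) hphi.
exists c; split; first exact: lt_le_trans ac.
  by rewrite distrC [leRHS]distrC !ger0_norm ?subr_ge0 ?(ltW aa)// lerD2l lerN2.
by rewrite -opprB h -mulrN opprB.
Qed.

(** The chain rule from continuous partial derivatives: the increment is split into one step per
    variable, and the mean value theorem is applied to each step. *)
Lemma is_derive_segment f (a b s r t : R) : C1_quadrant f ->
  0 < a + t * s -> 0 < b + t * r ->
  is_derive t (1 : R) (fun t => f (a + t * s) (b + t * r))
    (partial1 f (a + t * s) (b + t * r) * s + partial2 f (a + t * s) (b + t * r) * r).
Proof.
move=> /C1_quadrant_partials[_ pc fd _].
set A := a + t * s; set B := b + t * r => A0 B0.
set L := (X in is_derive _ _ _ X).
suff H : (fun h : R => h^-1 *: (f (a + (h *: (1 : R) + t) * s) (b + (h *: (1 : R) + t) * r)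
      - f A B)) @ 0^' --> L.
  split; first by apply/cvg_ex; exists L; exact: H.
  by apply: cvg_lim => //; exact: H.
apply/cvgrPdist_le => e e0.
pose e1 := e / (`|s| + `|r| + 1).
have sr0 : 0 < `|s| + `|r| + 1 by rewrite ltr_wpDl// addr_ge0.
have e10 : 0 < e1 by rewrite divr_gt0.
have [d d0 hd] := pc A B e1 A0 B0 e10.
(* Increments below [A] and [B] keep the moved point in the open quadrant, where the derivatives
   exist. *)
pose d' := Num.min d (Num.min A B).
have d'0 : 0 < d' by rewrite !lt_min d0 A0 B0.
near=> h.
have h0 : h != 0 by near: h; exact: nbhs_dnbhs_neq.
have hs : `|h| * (`|s| + `|r| + 1) < d'.
  rewrite -ltr_pdivlMr//; near: h.
  apply: nbhs_dnbhs; exists (d' / (`|s| + `|r| + 1)); first by rewrite /= divr_gt0.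
  by move=> x /=; rewrite sub0r normrN.
rewrite [h *: 1]mulr1.
have -> : a + (h + t) * s = A + h * s by rewrite /A; ring.
have -> : b + (h + t) * r = B + h * r by rewrite /B; ring.
have hs1 : `|h * s| < d'.
  apply: le_lt_trans hs; rewrite normrM ler_wpM2l// -addrA lerDl addr_ge0//.
have hr1 : `|h * r| < d'.
  by apply: le_lt_trans hs; rewrite normrM ler_wpM2l// [_ + `|r|]addrC -addrA lerDl addr_ge0.
have A'0 : 0 < A + h * s.
  have : `|h * s| < A by apply: lt_le_trans hs1 _; rewrite !ge_min lexx !orbT.
  by rewrite ltr_norml => /andP[+ _]; rewrite -subr_gt0 opprK addrC.
have B'0 : 0 < B + h * r.
  have : `|h * r| < B by apply: lt_le_trans hr1 _; rewrite !ge_min lexx !orbT.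
  by rewrite ltr_norml => /andP[+ _]; rewrite -subr_gt0 opprK addrC.
have d1 (x : R) : 0 < x -> is_derive x (1 : R) (fun x => f x (B + h * r)) (partial1 f x (B + h * r)).
  by move=> x0; exact: (fd _ _ x0 B'0).1.
have d2 (y : R) : 0 < y -> is_derive y (1 : R) (f A) (partial2 f A y).
  by move=> y0; exact: (fd _ _ A0 y0).2.
have [xi [xi0 xiA E1]] := MVT_between A0 A'0 d1.
have [eta [eta0 etaB E2]] := MVT_between B0 B'0 d2.
have dd : d' <= d by rewrite ge_min lexx.
have addK (x y : R) : x + y - x = y by rewrite addrAC subrr add0r.
rewrite addK in xiA E1; rewrite addK in etaB E2.
have [H1 _] : `|partial1 f xi (B + h * r) - partial1 f A B| < e1 /\
    `|partial2 f xi (B + h * r) - partial2 f A B| < e1.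
  apply: hd => //; first exact: le_lt_trans xiA (lt_le_trans hs1 dd).
  by rewrite addK; exact: lt_le_trans hr1 dd.
have [_ H2] : `|partial1 f A eta - partial1 f A B| < e1 /\
    `|partial2 f A eta - partial2 f A B| < e1.
  apply: hd => //; first by rewrite subrr normr0.
  exact: le_lt_trans etaB (lt_le_trans hr1 dd).
have -> : f (A + h * s) (B + h * r) - f A B =
   partial1 f xi (B + h * r) * (h * s) + partial2 f A eta * (h * r).
  by rewrite -E1 -E2 addrA subrK.
have -> : L - h^-1 *: (partial1 f xi (B + h * r) * (h * s) + partial2 f A eta * (h * r)) =
   - ((partial1 f xi (B + h * r) - partial1 f A B) * s +
      (partial2 f A eta - partial2 f A B) * r).
  have H (p q p' q' : R) : (q * s + q' * r) - h^-1 * (p * (h * s) + p' * (h * r)) =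
      - ((p - q) * s + (p' - q') * r) by field.
  exact: H.
rewrite normrN; apply: le_trans (ler_normD _ _) _; rewrite !normrM.
apply: (@le_trans _ _ (e1 * `|s| + e1 * `|r|)).
  by apply: lerD; apply: ler_wpM2r; [exact: normr_ge0|exact: ltW|exact: normr_ge0|exact: ltW].
rewrite -mulrDr /e1 mulrAC ler_pdivrMr// ler_wpM2l ?(ltW e0)//.
by rewrite lerDl.
Unshelve. all: by end_near. Qed.

(** The one-variable mean value theorem along the segment. The bounds by maxima keep the
    intermediate point in the square where the partial derivatives are bounded by [K]. *)
Lemma segment_MVT f (a b a' b' : R) : C1_quadrant f ->
  0 < a -> 0 < b -> 0 < a' -> 0 < b' ->
  exists c d, [/\ 0 < c <= Num.max a a', 0 < d <= Num.max b b' &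
    f a' b' - f a b = partial1 f c d * (a' - a) + partial2 f c d * (b' - b)].
Proof.
move=> fC a0 b0 a'0 b'0.
have conv (p q t : R) : 0 < p -> 0 < q -> 0 <= t <= 1 ->
    0 < p + t * (q - p) <= Num.max p q.
  move=> p0 q0 /andP[t0 t1]; rewrite (_ : p + _ = (1 - t) * p + t * q); last by ring.
  have t1' : 0 <= 1 - t by rewrite subr_ge0.
  apply/andP; split.
    have [->|t_neq0] := eqVneq t 0; first by rewrite subr0 mul1r mul0r addr0.
    by rewrite ltr_wpDl ?mulr_ge0 ?(ltW p0)// mulr_gt0// lt_neqAle eq_sym t_neq0.
  have h1 : (1 - t) * p <= (1 - t) * Num.max p q by rewrite ler_wpM2l// le_max lexx.
  have h2 : t * q <= t * Num.max p q by rewrite ler_wpM2l// le_max lexx orbT.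
  by apply: le_trans (lerD h1 h2) _; rewrite -mulrDl subrK mul1r.
pose phi (t : R) := f (a + t * (a' - a)) (b + t * (b' - b)).
pose dphi (t : R) := partial1 f (a + t * (a' - a)) (b + t * (b' - b)) * (a' - a) +
    partial2 f (a + t * (a' - a)) (b + t * (b' - b)) * (b' - b).
have D (t : R) : 0 <= t <= 1 -> is_derive t (1 : R) phi (dphi t).
  move=> t01; have /andP[A0 _] := conv _ _ _ a0 a'0 t01.
  by have /andP[B0 _] := conv _ _ _ b0 b'0 t01; exact: is_derive_segment.
have D' (t : R) : t \in `]0, 1[ -> is_derive t (1 : R) phi (dphi t).
  by rewrite in_itv/= => /andP[t0 t1]; apply: D; rewrite !ltW.
have [|t] := MVT_segment ler01 D'.
  apply: derivable_within_continuous => t; rewrite in_itv/= => t01.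
  exact: (@ex_derive _ _ _ _ _ _ _ (D t t01)).
rewrite in_itv/= => t01; rewrite /phi /dphi !mul1r !mul0r !addr0 subr0 mulr1.
rewrite [a + (_ - _)]addrC [b + (_ - _)]addrC !subrK => ->.
by exists (a + t * (a' - a)), (b + t * (b' - b)); split=> //; exact: conv.
Qed.

End quadrant_calculus.

(** * The narrow region principle *)

Lemma continuous_reflect (R : realType) n (lambda : R) :
  continuous (@reflect_x1 R n lambda).
Proof.
move=> x.
apply/(@cvgrPdist_lt _ _ _ (nbhs (x : 'rV[R]_n.+1)) (nbhs_filter (x : 'rV[R]_n.+1))) => e e0.
have N0 : 0 < n.+1%:R :> R by rewrite ltr0n.
apply/(@nbhs_ballP _ 'rV[R]_n.+1); exists (e / n.+1%:R); first by rewrite /= divr_gt0.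
move=> y; rewrite -ball_normE /ball_ /= => xy.
apply: (le_lt_trans (norm_le_enorm _)); rewrite enorm_reflect_sub.
apply: (le_lt_trans (enorm_le_norm _)).
by rewrite mulrC -ltr_pdivlMr.
Qed.

(** * Both operators at a negative minimum of the reflected difference *)

Section reflected_operators.
Context {R : realType} {n : nat}.
Local Notation V := 'rV[R]_n.+1.
Local Notation mu := (lebesgue_rV n.+1).
Variables (alpha M lambda : R) (u : V -> R) (x : V).
Hypotheses (alpha_gt0 : 0 < alpha) (umeas : measurable_fun setT u).
Hypothesis (uM : forall y, `|u y| <= M).
Local Notation w := (reflect_diff u lambda).
Local Notation s := (@reflect_x1 R n lambda).
Hypotheses (xl : x ord0 ord0 < lambda) (wx0 : w x < 0).
Hypothesis (wmin : forall y : V, y ord0 ord0 < lambda -> w x <= w y).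

Let mw : measurable_fun [set: V] w.
Proof.
apply: measurable_funB; last exact: umeas.
exact: (measurableT_comp umeas (measurable_reflect lambda)).
Qed.

Let wM y : `|w y| <= M + M.
Proof. by apply: (le_trans (ler_normB _ _)); exact: lerD. Qed.

(** The common step for both operators: [A] is the complement of a ball for the fractional Laplacian
    and the upper half-space for the normal derivative. *)
Lemma reflected_integral_le (A E : set V) (eps c : R) :
  0 < eps -> measurable A -> (forall y, A y -> eps <= enorm (x - y)) ->
  (forall y : V, y ord0 ord0 < lambda -> A y -> A (s y)) ->
  (forall y : V, y ord0 ord0 < lambda -> A (s y) -> ~ A y -> w y <= 0) ->
  measurable E -> ((mu : {measure set V -> \bar R}) E < +oo)%E -> E `<=` A ->
  (forall y, E y -> lambda < y ord0 ord0 /\ c <= ker alpha (x - y)) -> 0 <= c ->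
  \int[mu]_(y in s @^-1` A) ((u (s x) - u y) * ker alpha (s x - y)) -
  \int[mu]_(y in A) ((u x - u y) * ker alpha (x - y)) <=
  w x * c * fine ((mu : {measure set V -> \bar R}) E).
Proof.
move=> e0 mA Ae Arefl Anew mE muE EA Ec c0.
rewrite -(reflect_diff_integral lambda alpha_gt0 umeas uM e0 mA Ae).
exact: (reflection_comparison alpha_gt0 mw wM (reflect_diffN u lambda) xl
  (ltW wx0) wmin e0 mA Ae Arefl Anew mE muE EA Ec c0).
Qed.

(** The bound is proved for truncated integrals with [eps] small and passes to the limit. The cube
    [E] has side d and lies beyond the hyperplane within 2(n+1)d of x, so kernel bound times volume
    is a constant times d^(-alpha). *)
Lemma frac_laplacian_reflect_le (theta : R) :
  alpha < 2 -> Num.max 0 (alpha - 1) < theta -> C1_holder_loc theta u ->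
  frac_laplacian alpha u (s x) - frac_laplacian alpha u x <=
  frac_const (n := n) alpha * (w x * (((2 * n.+1%:R) `^ (n.+1%:R + alpha))^-1 *
    (lambda - x ord0 ord0) `^ (- alpha))).
Proof.
move=> a2 theta_gt uC; set d := lambda - _; set c := (_ * d `^ _).
have d0 : 0 < d by rewrite subr_gt0.
have C0 : 0 < frac_const (n := n) alpha by rewrite frac_const_gt0// alpha_gt0.
rewrite !(frac_laplacianE alpha_gt0 theta_gt umeas uC uM) -mulrBr ler_pM2l//.
have cv := truncated_integral_cvg alpha_gt0 theta_gt umeas uC uM.
apply: (cvgr_to_le (cvgB (cv (s x)) (cv x))).
have cw : {for x, continuous w}.
  move=> /=; apply: continuousB; last exact/differentiable_continuous/(uC.1 x).
  by apply: continuous_comp; [exact: continuous_reflect|exact/differentiable_continuous/(uC.1 _)].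
(* This radius controls the points that the truncation at x removes while keeping their
   reflections. *)
have [r r0 hr] : exists2 r : R, 0 < r & forall y : V, enorm (x - y) < r -> w y <= 0.
  have /cvgrPdist_lt/(_ (- w x)) := cw; rewrite oppr_gt0 => /(_ wx0).
  move=> /nbhs_ballP[r r0 hr]; exists r => // y xy.
  have : ball x r y by rewrite -ball_normE /ball_ /=; exact: le_lt_trans (norm_le_enorm _) xy.
  move=> /hr /=; rewrite ltr_distlC => /andP[_]; lra.
near=> eps.
have e0 : 0 < eps by near: eps; exact: nbhs_right_gt.
(* As [E] lies beyond the hyperplane, at distance d from x, the excised ball does not meet it. *)
have ed : eps < d by near: eps; exact: nbhs_right_lt.
have er : eps < r by near: eps; exact: nbhs_right_lt.
pose N : R := n.+1%:R.
pose k := ((2 * N * d) `^ (N + alpha))^-1.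
have Nd0 : 0 < 2 * N * d by rewrite mulr_gt0// mulr_gt0// ltr0n.
pose E : set V := box (fun i => x ord0 i + (if i == ord0 then d else 0)) d.
have mE : measurable E by exact: measurable_box.
have Ebox y i : E y -> 0 < y ord0 i - x ord0 i < 2 * d.
  by move=> /(_ i); case: ifP => _ /andP[]; lra.
have E1 y : E y -> lambda < y ord0 ord0.
  by move=> /(_ ord0) /=; rewrite /d => /andP[]; lra.
have Eaway y : E y -> eps <= enorm (x - y).
  move=> Ey; apply: (le_trans _ (coord_le_enorm _ ord0)).
  rewrite !mxE distrC ger0_norm; first by move: ed; have := E1 _ Ey; rewrite /d; lra.
  by have /andP[/ltW] := Ebox _ ord0 Ey.
have Eker y : E y -> k <= ker alpha (x - y).
  move=> Ey; have p0 : 0 <= N + alpha by rewrite addr_ge0// ?ler0n// ltW.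
  have xy0 : 0 < enorm (x - y) := lt_le_trans e0 (Eaway _ Ey).
  rewrite lef_pV2 ?posrE ?powR_gt0// ge0_ler_powR ?nnegrE ?enorm_ge0 ?(ltW Nd0)//.
  rewrite [2 * N]mulrC -mulrA; apply: enorm_le_coord; first by rewrite mulr_ge0 ?ltW.
  move=> i; have /andP[h1 h2] := Ebox _ i Ey.
  by rewrite !mxE distrC ger0_norm ltW.
have muE := lebesgue_box (n := n) (fun i => x ord0 i + (if i == ord0 then d else 0)) d0.
have dE : d `^ (N + alpha) = d ^+ n.+1 * d `^ alpha.
  by rewrite powRD ?(gt_eqF d0) ?implybT// powR_mulrn ?(ltW d0).
have kc : k * d ^+ n.+1 = c.
  rewrite /k /c -/N powRM ?mulr_ge0 ?ler0n ?(ltW d0)// dE powRN.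
  have H (p q t : R) : q != 0 -> (p * (q * t))^-1 * q = p^-1 * t^-1.
    by move=> q0; rewrite mulrCA invfM mulrAC mulVf// mul1r invfM.
  by apply: H; rewrite expf_neq0// gt_eqF.
have -> : w x * c = w x * k * fine ((mu : {measure set V -> \bar R}) E).
  by rewrite muE /= -mulrA kc.
rewrite -[leLHS]/(\int[mu]_(y in [set y | eps <= enorm (s x - y)]) ((u (s x) - u y) * ker alpha (s x - y)) -
  \int[mu]_(y in [set y | eps <= enorm (x - y)]) ((u x - u y) * ker alpha (x - y))).
have -> : [set y | eps <= enorm (s x - y)] = s @^-1` [set y | eps <= enorm (x - y)].
  by apply/seteqP; split => y /=; rewrite -(enorm_sub_reflect lambda).
apply: (reflected_integral_le e0) => //.
- exact: measurable_away.
- by move=> y yl /= h; apply: (le_trans h); apply: enorm_le_reflect; exact: ltW.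
- move=> y yl _ /= /negP; rewrite -ltNge => h; apply: hr; exact: lt_trans er.
- by rewrite muE ltry.
- by move=> y Ey; split; [exact: E1|exact: Eker].
- by rewrite invr_ge0 powR_ge0.
Unshelve. all: by end_near. Qed.

(** In dimension at least 2 the first and last coordinates differ, so the reflection preserves the
    upper half-space. Since x lies below it, the kernel is not singular there; strictness comes from
    a unit cube of positive measure. *)
Lemma nonlocal_normal_reflect_lt : (0 < n)%N -> alpha < 2 -> x ord0 ord_max < 0 ->
  nonlocal_normal alpha u (s x) < nonlocal_normal alpha u x.
Proof.
move=> n0 a2 xn0; rewrite -subr_lt0 /nonlocal_normal -mulrBr.
rewrite pmulr_rlt0; last by rewrite frac_const_gt0// alpha_gt0.
have max0 : ord_max != ord0 :> 'I_n.+1 by rewrite -val_eqE /= -lt0n.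
pose K : R := `|x| + `|lambda| + 2.
have K0 : 0 < K by rewrite ltr_wpDl// addr_ge0.
pose k := ((n.+1%:R * K) `^ (n.+1%:R + alpha))^-1.
(* [K] bounds each coordinate of x - y for y in the unit cube [E] below, so [k] bounds the kernel
   from below on [E]. *)
have NK0 : 0 < n.+1%:R * K by rewrite mulr_gt0.
have k0 : 0 < k by rewrite invr_gt0 powR_gt0.
pose a (i : 'I_n.+1) : R := if i == ord0 then lambda else 0.
pose E : set V := box a 1.
have mE : measurable E by exact: measurable_box.
have muE := lebesgue_box (n := n) a ltr01.
have mA : measurable (@upper_half_space R n).
  rewrite (_ : upper_half_space = (fun y : V => y ord0 ord_max) @^-1` `]0, +oo[%classic).
    rewrite -[X in measurable X]setTI.
    by apply: (@measurable_coord _ R) => //; exact: measurable_itv.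
  by apply/seteqP; split => y /=; rewrite in_itv/= andbT.
have e0 : 0 < - x ord0 ord_max by rewrite oppr_gt0.
have Aaway (y : V) : upper_half_space y -> - x ord0 ord_max <= enorm (x - y).
  rewrite /upper_half_space /= => y0; apply: (le_trans _ (coord_le_enorm _ ord_max)).
  by rewrite !mxE ltr0_norm; lra.
have sA (y : V) : upper_half_space (s y) <-> upper_half_space y.
  by rewrite /upper_half_space /= reflect_coord.
have EA : E `<=` upper_half_space.
  by move=> y /(_ ord_max); rewrite /a (negbTE max0) => /andP[].
have E1 (y : V) : E y -> lambda < y ord0 ord0.
  by move=> /(_ ord0); rewrite /a eqxx => /andP[].
have Eker (y : V) : E y -> k <= ker alpha (x - y).
  move=> Ey; have p0 : 0 <= n.+1%:R + alpha by rewrite addr_ge0// ?ler0n// ltW.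
  have xy0 : 0 < enorm (x - y) := lt_le_trans e0 (Aaway _ (EA _ Ey)).
  rewrite lef_pV2 ?posrE ?powR_gt0// ge0_ler_powR ?nnegrE ?enorm_ge0 ?(ltW NK0)//.
  apply: enorm_le_coord; first exact: ltW.
  move=> i; rewrite !mxE; apply: (le_trans (ler_normB _ _)).
  have xi : `|x ord0 i| <= `|x|.
    by rewrite [`|x|]mx_normrE; exact: (le_bigmax _ (fun ij => `|x ij.1 ij.2|) (ord0, i)).
  rewrite /K -addrA lerD//; have /andP[y1 y2] := Ey i.
  have ai : `|a i| <= `|lambda| by rewrite /a; case: ifP; rewrite ?normr0.
  have : `|y ord0 i| <= `|a i| + 1.
    rewrite -[y ord0 i](subrK (a i)); apply: (le_trans (ler_normD _ _)).
    by rewrite [leRHS]addrC lerD2r ger0_norm; lra.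
  lra.
have h := @reflected_integral_le upper_half_space E (- x ord0 ord_max) k e0 mA Aaway.
have sAE : s @^-1` upper_half_space = upper_half_space.
  by apply/seteqP; split => y /sA.
rewrite sAE muE /= expr1n mulr1 in h.
have : w x * k < 0 by rewrite nmulr_rlt0.
apply: le_lt_trans; apply: h => //.
- by move=> y _ /sA.
- by move=> y _ /sA.
- by rewrite ltry.
- by move=> y Ey; split; [exact: E1|exact: Eker].
- exact: ltW.
Qed.

End reflected_operators.

(** * From the operator inequalities to the system *)

Section system.
Context {R : realType} {n : nat}.
Local Notation V := 'rV[R]_n.+1.
Implicit Types (u v : V -> R) (x : V).

Lemma not_closure_upper_half_space x :
  x ord0 ord_max < 0 -> ~ closure (@upper_half_space R n) x.
Proof.
move=> x0.
have cl : closed [set y : V | 0 <= y ord0 ord_max].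
  rewrite (_ : [set y | _] = (fun y : V => y ord0 ord_max) @^-1` [set t | 0 <= t])//.
  by apply: closed_comp; [move=> y _; exact: coord_continuous|exact: closed_ge].
move/(closure_id _).1 : cl => cl.
move=> clx.
have sub : @upper_half_space R n `<=` [set y : V | 0 <= y ord0 ord_max].
  by move=> y /ltW.
by have := closure_subset sub clx; rewrite -cl /= leNgt x0.
Qed.

(** A boundary point is approached from inside along the last axis, and both sides of the equation
    are continuous along this sequence. *)
Lemma frac_laplacian_eq_closed (alpha theta M : R) (f : R -> R -> R) u v :
  0 < alpha -> Num.max 0 (alpha - 1) < theta -> C1_quadrant f ->
  measurable_fun setT u -> C1_holder_loc theta u -> (forall x, `|u x| <= M) ->
  (forall x, 0 < u x) -> (forall x, 0 < v x) -> continuous v ->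
  (forall x, upper_half_space x -> frac_laplacian alpha u x = f (u x) (v x)) ->
  forall x, 0 <= x ord0 ord_max -> frac_laplacian alpha u x = f (u x) (v x).
Proof.
move=> a0 theta_gt fC umeas uC uM u0 v0 cv eqf x xn0.
have [cf _ _ _] := C1_quadrant_partials fC.
have cu : continuous u by move=> y; exact/differentiable_continuous/(uC.1 y).
pose e : V := delta_mx ord0 ord_max.
(* The steps 1/(k+1) are positive and at most 1, so the sequence stays in the unit ball where the
   common majorant applies. *)
pose x_ (k : nat) : V := x + k.+1%:R^-1 *: e.
have ee : enorm e <= 1.
  rewrite -(@ler_pXn2r _ 2)// ?nnegrE ?enorm_ge0// sqr_enorm expr1n.
  rewrite (bigD1 ord_max)//= big1 ?addr0 ?mxE ?eqxx ?expr1n//.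
  by move=> i /negbTE iN; rewrite mxE iN andbF expr0n.
have xk1 k : enorm (x_ k - x) <= 1.
  rewrite /x_ addrAC subrr add0r enormZ ger0_norm ?invr_ge0//.
  by rewrite mulr_ile1 ?enorm_ge0 ?invr_ge0// invf_le1// ler1n.
have xcvg : x_ k @[k --> \oo] --> x.
  rewrite -[X in _ --> X]addr0; apply: cvgD; first exact: cvg_cst.
  rewrite -[X in _ --> X](scale0r e); apply: cvgZl.
  exact: cvg_harmonic.
have cvl := frac_laplacian_cvg_seq a0 theta_gt umeas uC uM xk1 xcvg.
have eqk k : frac_laplacian alpha u (x_ k) = f (u (x_ k)) (v (x_ k)).
  apply: eqf; rewrite /upper_half_space /= !mxE !eqxx mulr1.
  by rewrite ltr_wpDl// invr_gt0.
have cvr : f (u (x_ k)) (v (x_ k)) @[k --> \oo] --> f (u x) (v x).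
  have ucvg : u (x_ k) @[k --> \oo] --> u x by apply: (cvg_comp _ _ xcvg); exact: cu.
  have vcvg : v (x_ k) @[k --> \oo] --> v x by apply: (cvg_comp _ _ xcvg); exact: cv.
  exact: (within_quadrant_cvg cf (fun k => ltW (u0 (x_ k))) (fun k => ltW (v0 (x_ k)))
    (ltW (u0 x)) (ltW (v0 x)) ucvg vcvg).
apply: (cvg_unique _ _ cvr) => //.
by rewrite -(funext eqk).
Qed.

(** One half of the principle, for the first unknown; the other half is this one with the unknowns
    exchanged. *)
Lemma narrow_region_component (alpha theta mu M : R) (f h : R -> R -> R) u v :
  (0 < n)%N -> 0 < alpha < 2 -> C1_quadrant f -> C1_quadrant h ->
  Num.max 0 (alpha - 1) < theta -> measurable_fun setT u -> C1_holder_loc theta u ->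
  continuous v -> (forall x, 0 < u x <= M) -> (forall x, 0 < v x <= M) ->
  (forall x, upper_half_space x -> frac_laplacian alpha u x = f (u x) (v x)) ->
  (forall x, ~ closure upper_half_space x ->
    nonlocal_normal alpha u x = h (u x) (v x)) ->
  (forall a b : R, 0 < a -> 0 < b -> 0 < partial2 f a b) ->
  (forall a b : R, 0 < a -> 0 < b -> 0 < partial2 h a b) -> 0 < mu ->
  (forall a b : R, 0 < a -> 0 < b -> mu * partial2 h a b <= - partial1 h a b) ->
  exists2 ell0 : R, 0 < ell0 & forall ell lambda : R, 0 < ell <= ell0 ->
    forall xs, slab lambda ell xs ->
      (forall x, closure (half_space lambda) x ->
        reflect_diff u lambda xs <= reflect_diff u lambda x) ->
      reflect_diff u lambda xs < 0 ->
      reflect_diff v lambda xs < mu * reflect_diff u lambda xs < 0.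
Proof.
move=> n0 /andP[a0 a2] fC hC theta_gt umeas uC cv u0M v0M eqf eqh f2_gt0 h2_gt0 mu0 hmu.
have u0 x : 0 < u x by case/andP: (u0M x).
have v0 x : 0 < v x by case/andP: (v0M x).
have uM x : `|u x| <= M by case/andP: (u0M x) => ux0; rewrite gtr0_norm.
have M0 : 0 <= M by exact: le_trans (uM 0).
have maxM (a b : R) : a <= M -> b <= M -> Num.max a b <= M by move=> *; rewrite ge_max; apply/andP.
have [_ _ _ /(_ M M0)[K K0 hK]] := C1_quadrant_partials fC.
have C0 : 0 < frac_const (n := n) alpha by rewrite frac_const_gt0// a0.
pose kappa := frac_const (n := n) alpha * ((2 * n.+1%:R) `^ (n.+1%:R + alpha))^-1.
have kappa0 : 0 < kappa by rewrite mulr_gt0// invr_gt0 powR_gt0// mulr_gt0// ltr0n.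
(* One [K] absorbs the term in f_u and [K * mu] yields the factor mu; the width below solves kappa
   ell^(-alpha) = T. *)
pose T := K * (1 + mu).
have T0 : 0 < T by rewrite mulr_gt0// addr_gt0.
exists ((kappa / T) `^ alpha^-1); first by rewrite powR_gt0// divr_gt0.
move=> ell lambda /andP[ell0 ell_le] x [xl /andP[xl1 _]] xmin wx0.
have wmin (y : 'rV[R]_n.+1) : y ord0 ord0 < lambda ->
    reflect_diff u lambda x <= reflect_diff u lambda y.
  by move=> yl; apply: xmin; exact: subset_closure.
rewrite pmulr_rlt0// wx0 andbT.
set s := reflect_x1 lambda x.
have sn : s ord0 ord_max = x ord0 ord_max by rewrite reflect_coord// -val_eqE /= -lt0n.
have [xn|xn] := ltP (x ord0 ord_max) 0.
  have := nonlocal_normal_reflect_lt a0 umeas uM xl wx0 wmin n0 a2 xn.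
  rewrite eqh; last by apply: not_closure_upper_half_space; rewrite sn.
  rewrite eqh; last exact: not_closure_upper_half_space.
  rewrite -/s -subr_lt0.
  have [c [d [/andP[c0 _] /andP[d0 _] ->]]] := segment_MVT hC (u0 x) (v0 x) (u0 s) (v0 s).
  have h2 := h2_gt0 _ _ c0 d0; have hm := hmu _ _ c0 d0.
  rewrite -/(reflect_diff u lambda x) -/(reflect_diff v lambda x).
  move: (reflect_diff u lambda x) (reflect_diff v lambda x) (partial1 h c d) (partial2 h c d) wx0 h2 hm.
  move=> U W p q U0 q0 pq H.
  (* From p U + q W < 0, with -p >= mu q and U < 0, one gets q W < -p U <= mu q U. *)
  have : q * W < q * (mu * U).
    have : (- p) * U <= mu * q * U by rewrite ler_wnM2r// ltW.
    have -> : q * (mu * U) = mu * q * U by ring.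
    lra.
  by rewrite ltr_pM2l.
have d0 : 0 < lambda - x ord0 ord0 by rewrite subr_gt0.
have := frac_laplacian_reflect_le a0 umeas uM xl wx0 wmin a2 theta_gt uC.
have eqc := frac_laplacian_eq_closed a0 theta_gt fC umeas uC uM u0 v0 cv eqf.
rewrite eqc; last by rewrite sn.
rewrite eqc// -/s.
have [c [d [/andP[c0 cM] /andP[d'0 dM] ->]]] := segment_MVT fC (u0 x) (v0 x) (u0 s) (v0 s).
have f2 := f2_gt0 _ _ c0 d'0.
have [k1 k2] : `|partial1 f c d| <= K /\ `|partial2 f c d| <= K.
  have uxM y : u y <= M by case/andP: (u0M y).
  have vxM y : v y <= M by case/andP: (v0M y).
  apply: hK; first by rewrite c0 (le_trans cM) ?maxM.
  by rewrite d'0 (le_trans dM) ?maxM.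
rewrite -/(reflect_diff u lambda x) -/(reflect_diff v lambda x).
have dT : T < kappa * (lambda - x ord0 ord0) `^ (- alpha).
  rewrite powRN ltr_pdivlMr ?powR_gt0// -ltr_pdivlMl// mulrC.
  have de : lambda - x ord0 ord0 < (kappa / T) `^ alpha^-1.
    apply: lt_le_trans ell_le; lra.
  have := gt0_ltr_powR a0 _ _ de; rewrite !nnegrE (ltW d0) powR_ge0 => /(_ isT isT).
  by rewrite -powRrM mulVf ?gt_eqF// powRr1// divr_ge0 ?ltW.
move=> H; have {}H : partial1 f c d * reflect_diff u lambda x +
    partial2 f c d * reflect_diff v lambda x <=
    kappa * (lambda - x ord0 ord0) `^ (- alpha) * reflect_diff u lambda x.
  by apply: le_trans H _; rewrite /kappa [reflect_diff _ _ _ * _]mulrC !mulrA.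
move: (reflect_diff u lambda x) (reflect_diff v lambda x) (partial1 f c d) (partial2 f c d)
  (kappa * _) wx0 f2 k1 k2 dT H.
move=> U W p q S U0 q0 pK qK TS H.
(* q W <= S U - p U < T U - K U, as U < 0, T < S and p <= K. *)
have qW : q * W < K * (mu * U).
  have h1 : S * U < T * U by rewrite ltr_nM2r.
  have h2 : (- p) * U <= - K * U.
    by rewrite ler_wnM2r ?(ltW U0)// lerNr opprK; exact: le_trans (ler_norm _) pK.
  have h3 : T * U = K * U + K * (mu * U) by rewrite /T; ring.
  lra.
(* The sign of W is needed before q can be replaced by its upper bound: K W <= q W < K mu U. *)
have W0 : W < 0.
  rewrite -(pmulr_rlt0 _ q0); apply: lt_trans qW _.
  by rewrite pmulr_rlt0// pmulr_rlt0.
rewrite -(ltr_pM2l K0); apply: le_lt_trans qW.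
rewrite ler_wnM2r ?(ltW W0)//; exact: le_trans (ler_norm _) qK.
Qed.

End system.

(* The dimension is m.+2. *)
Theorem lemma4 (R : realType) (m : nat) (alpha theta mu nu : R)
    (f g h l : R -> R -> R) (u v : 'rV[R]_m.+2 -> R)
    (alpha02 : 0 < alpha < 2)
    (f_C1 : C1_quadrant f) (g_C1 : C1_quadrant g)
    (h_C1 : C1_quadrant h) (l_C1 : C1_quadrant l)
    (theta_gt : Num.max 0 (alpha - 1) < theta)
    (u_L : in_L alpha u) (v_L : in_L alpha v)
    (u_C1 : C1_holder_loc theta u) (v_C1 : C1_holder_loc theta v)
    (u_gt0 : forall x, 0 < u x) (v_gt0 : forall x, 0 < v x)
    (eq_f : forall x, upper_half_space x ->
      frac_laplacian alpha u x = f (u x) (v x))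
    (eq_g : forall x, upper_half_space x ->
      frac_laplacian alpha v x = g (u x) (v x))
    (eq_h : forall x, ~ closure upper_half_space x ->
      nonlocal_normal alpha u x = h (u x) (v x))
    (eq_l : forall x, ~ closure upper_half_space x ->
      nonlocal_normal alpha v x = l (u x) (v x))
    (u_infty : vanishes_at_infty u) (v_infty : vanishes_at_infty v)
    (f2_gt0 : forall a b, 0 < a -> 0 < b -> 0 < partial2 f a b)
    (g1_gt0 : forall a b, 0 < a -> 0 < b -> 0 < partial1 g a b)
    (h1_lt0 : forall a b, 0 < a -> 0 < b -> partial1 h a b < 0)
    (l2_lt0 : forall a b, 0 < a -> 0 < b -> partial2 l a b < 0)
    (h2_gt0 : forall a b, 0 < a -> 0 < b -> 0 < partial2 h a b)
    (l1_gt0 : forall a b, 0 < a -> 0 < b -> 0 < partial1 l a b)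
    (mu_gt0 : 0 < mu) (nu_gt0 : 0 < nu) (munu_gt1 : 1 < mu * nu)
    (h_mu : forall a b, 0 < a -> 0 < b ->
      mu * partial2 h a b <= - partial1 h a b)
    (l_nu : forall a b, 0 < a -> 0 < b ->
      nu * partial1 l a b <= - partial2 l a b) :
  exists2 ell0 : R, 0 < ell0 &
    forall ell lambda : R, 0 < ell <= ell0 ->
      (forall xs, slab lambda ell xs ->
         (forall x, closure (half_space lambda) x ->
            reflect_diff u lambda xs <= reflect_diff u lambda x) ->
         reflect_diff u lambda xs < 0 ->
         reflect_diff v lambda xs < mu * reflect_diff u lambda xs < 0) /\
      (forall ys, slab lambda ell ys ->
         (forall y, closure (half_space lambda) y ->
            reflect_diff v lambda ys <= reflect_diff v lambda y) ->
         reflect_diff v lambda ys < 0 ->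
         reflect_diff u lambda ys < nu * reflect_diff v lambda ys < 0).
Proof.
have /andP[alpha_gt0 _] := alpha02.
have [umeas _] := u_L; have [vmeas _] := v_L.
have cu : continuous u by move=> x; exact/differentiable_continuous/(u_C1.1 x).
have cv : continuous v by move=> x; exact/differentiable_continuous/(v_C1.1 x).
have [Mu uMu] := vanishing_bounded cu u_infty.
have [Mv vMv] := vanishing_bounded cv v_infty.
pose M := Num.max Mu Mv.
have uM x : 0 < u x <= M.
  by rewrite u_gt0 /M le_max (le_trans (ler_norm _) (uMu x)).
have vM x : 0 < v x <= M.
  by rewrite v_gt0 /M le_max (le_trans (ler_norm _) (vMv x)) orbT.
have [e1 e10 H1] := narrow_region_component (ltn0Sn m) alpha02 f_C1 h_C1 theta_gt
  umeas u_C1 cv uM vM eq_f eq_h f2_gt0 h2_gt0 mu_gt0 h_mu.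
(* The roles of u and v are exchanged, so the arguments of g and l are swapped and their partial
   derivatives trade places. *)
have [e2 e20 H2] := narrow_region_component (ltn0Sn m) alpha02 (C1_quadrant_swap g_C1)
  (C1_quadrant_swap l_C1) theta_gt vmeas v_C1 cu vM uM eq_g eq_l
  (fun a b a0 b0 => g1_gt0 b a b0 a0) (fun a b a0 b0 => l1_gt0 b a b0 a0) nu_gt0
  (fun a b a0 b0 => l_nu b a b0 a0).
exists (Num.min e1 e2); first by rewrite lt_min e10.
move=> ell lambda /andP[ell0]; rewrite le_min => /andP[le1 le2]; split.
  by apply: H1; rewrite ell0.
by apply: H2; rewrite ell0.
Qed.
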